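(* Let $f$ be a tamely ramified rational function over a field $K$. If $f$ is a polynomial, then $\widehat K_f$ is small over $K$.
   Context: Let $t$ be transcendental over $K$, $\overline{K(t)}$ a separable closure of $K(t)$, $\bar K$ the algebraic closure of $K$ in it. $f$ is tamely ramified if $\bar K(x)/\bar K(t)$, $f(x)=t$, is tamely ramified. $f^{-\infty}(t)$ is the set of all solutions of $f^n(x)=t$, $n\ge0$, in $\overline{K(t)}$. $\widehat K_f$ is the constant field extension: the algebraic closure of $K$ in $K(f^{-\infty}(t))$, a Galois extension of $K$. A Galois extension $F/K$ is small if $\mathrm{Gal}(F/K)$ has only finitely many (open) subgroups of index $n$ for each integer $n$. *)

(* Defs.v *)
From HB Require Import structures.
From mathcomp Require Import all_boot all_order all_algebra.
From mathcomp Require Import separable.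
From mathcomp Require Import boolp classical_sets cardinality.

Set Implicit Arguments.
Unset Strict Implicit.
Unset Printing Implicit Defensive.

Import Order.TTheory GRing.Theory Num.Theory.
Local Open Scope ring_scope.

Section SubfieldType.
Variables (L : fieldType) (S : divringClosed L).

Inductive subfield_type := Subfield x & x \in S.
Definition subfield_val (u : subfield_type) : L := let: Subfield x _ := u in x.

HB.instance Definition _ := [isSub for subfield_val].
HB.instance Definition _ := [Choice of subfield_type by <:].
HB.instance Definition _ := [SubChoice_isSubIntegralDomain of subfield_type by <:].
HB.instance Definition _ := [SubIntegralDomain_isSubField of subfield_type by <:].

Section Corestriction.
Variables (K : fieldType) (i : {rmorphism K -> L}) (iS : forall a, i a \in S).

Definition corestr (a : K) : subfield_type := Subfield (iS a).

Fact corestr_zmod_morphism : zmod_morphism corestr.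
Proof. by move=> a b; apply: val_inj; rewrite /= !rmorphB. Qed.
Fact corestr_monoid_morphism : monoid_morphism corestr.
Proof. by split=> [|a b]; apply: val_inj; rewrite /= (rmorph1, rmorphM). Qed.

HB.instance Definition _ :=
  GRing.isZmodMorphism.Build K subfield_type corestr corestr_zmod_morphism.
HB.instance Definition _ :=
  GRing.isMonoidMorphism.Build K subfield_type corestr corestr_monoid_morphism.
End Corestriction.

End SubfieldType.

Section Adjunction.
Variables (K L : fieldType) (i : {rmorphism K -> L}) (A : set L).

Definition in_adjoin : {pred L} := fun x =>
  `[< forall S : divringClosed L,
        (forall a, i a \in S) -> (forall y, A y -> y \in S) -> x \in S >].

Fact in_adjoin_divring_closed : divring_closed in_adjoin.
Proof.
split=> [|x y /asboolP Sx /asboolP Sy|x y /asboolP Sx /asboolP Sy];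
  apply/asboolP=> S iS AS; first exact: rpred1.
- by apply: rpredB; [apply: Sx | apply: Sy].
- by apply: rpred_div; [apply: Sx | apply: Sy].
Qed.
HB.instance Definition _ :=
  GRing.isDivringClosed.Build L in_adjoin in_adjoin_divring_closed.

Fact base_in_adjoin a : i a \in in_adjoin.
Proof. by apply/asboolP=> S iS _; apply: iS. Qed.

(* The subfield K(A) of L. *)
Definition adjoin : fieldType := subfield_type in_adjoin.
Definition adjoin_base : {rmorphism K -> adjoin} := corestr base_in_adjoin.
End Adjunction.

Section RelativeAlgebraicClosure.
Variables (K L : fieldType) (i : {rmorphism K -> L}).

Definition in_algclosure : {pred L} := fun x => `[< algebraicOver i x >].

Fact in_algclosure_divring_closed : divring_closed in_algclosure.
Proof.
split=> [|x y /asboolP ax /asboolP ay|x y /asboolP ax /asboolP ay];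
  apply/asboolP.
- exact: algebraic1.
- exact: algebraic_sub.
- exact: algebraic_div.
Qed.
HB.instance Definition _ :=
  GRing.isDivringClosed.Build L in_algclosure in_algclosure_divring_closed.

Fact base_in_algclosure a : i a \in in_algclosure.
Proof. by apply/asboolP; apply: algebraic_id. Qed.

(* The algebraic closure of K in L. *)
Definition algclosure_in : fieldType := subfield_type in_algclosure.
Definition algclosure_base : {rmorphism K -> algclosure_in} :=
  corestr base_in_algclosure.
End RelativeAlgebraicClosure.

Section GaloisGroup.
Variables (K F : fieldType) (i : {rmorphism K -> F}).

Definition is_galois_aut (s : F -> F) : Prop :=
  [/\ zmod_morphism s, monoid_morphism s, bijective s
    & forall a, s (i a) = i a].

Inductive Gal := GalAut s & `[< is_galois_aut s >].
Definition gal_fun (s : Gal) : F -> F := let: GalAut s' _ := s in s'.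

HB.instance Definition _ := [isSub for gal_fun].
HB.instance Definition _ := [Choice of Gal by <:].

Lemma galP (s : Gal) : is_galois_aut (gal_fun s).
Proof. by case: s => s /= /asboolP. Qed.

Lemma galE (s t : Gal) : gal_fun s =1 gal_fun t -> s = t.
Proof. by move=> st; apply: val_inj; apply: funext. Qed.

Fact gal_one_subproof : `[< is_galois_aut id >].
Proof. by apply/asboolP; split=> //; exists id. Qed.
Definition gal_one : Gal := GalAut gal_one_subproof.

Fact gal_mul_subproof (s t : Gal) : `[< is_galois_aut (gal_fun s \o gal_fun t) >].
Proof.
have [sB [s1 sM] sbij si] := galP s; have [tB [t1 tM] tbij ti] := galP t.
apply/asboolP; split=> [x y||| a] /=; first by rewrite tB sB.
- by split=> [|x y] /=; rewrite ?t1 ?s1 // tM sM.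
- exact: bij_comp.
- by rewrite ti si.
Qed.
Definition gal_mul (s t : Gal) : Gal := GalAut (gal_mul_subproof s t).

Fact gal_inv_exists (s : Gal) :
  exists t : Gal, cancel (gal_fun s) (gal_fun t) /\ cancel (gal_fun t) (gal_fun s).
Proof.
have [sB [s1 sM] [t st ts] si] := galP s.
have tP : `[< is_galois_aut t >].
  apply/asboolP; split=> [x y||| a].
  - by rewrite -{1}[x]ts -{1}[y]ts -sB st.
  - split=> [|x y]; first by rewrite -s1 st.
    by rewrite -{1}[x]ts -{1}[y]ts -sM st.
  - by exists (gal_fun s).
  - by rewrite -{1}[i a]si st.
by exists (GalAut tP).
Qed.
Definition gal_inv (s : Gal) : Gal := projT1 (cid (gal_inv_exists s)).

Fact gal_mulA : associative gal_mul. Proof. by move=> r s t; apply: galE. Qed.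
Fact gal_mul1g : left_id gal_one gal_mul. Proof. by move=> s; apply: galE. Qed.
Fact gal_mulg1 : right_id gal_one gal_mul. Proof. by move=> s; apply: galE. Qed.
Fact gal_mulVg : left_inverse gal_one gal_inv gal_mul.
Proof.
by move=> s; apply: galE => x /=; rewrite /gal_inv; case: cid => t /= [-> _].
Qed.
Fact gal_mulgV : right_inverse gal_one gal_inv gal_mul.
Proof.
by move=> s; apply: galE => x /=; rewrite /gal_inv; case: cid => t /= [_ ->].
Qed.

HB.instance Definition _ :=
  isGroup.Build Gal gal_mulA gal_mul1g gal_mulg1 gal_mulVg gal_mulgV.

(* Krull topology: for F algebraic over K, the automorphisms agreeing with s
   on finitely many elements of F form a basis of neighbourhoods of s. *)
Definition krull_open (U : {pred Gal}) : Prop :=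
  forall s : Gal, s \in U ->
    exists r : seq F, forall s' : Gal,
      {in r, gal_fun s =1 gal_fun s'} -> s' \in U.

End GaloisGroup.

(* The n left cosets (g i) H partition G. *)
Definition has_index (G : groupType) (H : {pred G}) (n : nat) : Prop :=
  exists g : 'I_n -> G, forall s : G, exists! j : 'I_n, ((g j)^-1 * s)%g \in H.

(* Used for Galois extensions F of K only, whose Galois group is Gal i. *)
Definition small (K F : fieldType) (i : {rmorphism K -> F}) : Prop :=
  forall n : nat,
    finite_set [set H : {pred Gal i} |
      [/\ group_closed H, krull_open H & has_index H n]]%classic.

Definition is_separable_closure (F L : fieldType) (i : {rmorphism F -> L}) : Prop :=
  (forall x : L, exists2 p : {poly F}, separable_poly p & root (map_poly i p) x)
  /\ (forall p : {poly L}, separable_poly p -> (1 < size p)%N ->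
        exists x, root p x).

Section DiscreteValuations.

(* Normalized discrete valuations of F that are trivial on the image of k. The
   value at 0 is irrelevant: it is never used. *)
Definition discrete_valuation (k F : fieldType) (c : {rmorphism k -> F})
    (v : F -> int) : Prop :=
  [/\ forall x y, x != 0 -> y != 0 -> v (x * y) = v x + v y,
      forall x y, x != 0 -> y != 0 -> x + y != 0 ->
        Num.min (v x) (v y) <= v (x + y),
      exists2 x, x != 0 & v x = 1
    & forall a, a != 0 -> v (c a) = 0].

Definition val_ge (F : fieldType) (v : F -> int) (n : int) : {pred F} :=
  fun x => (x == 0) || (n <= v x).
Definition val_ring (F : fieldType) (v : F -> int) := val_ge v 0.
Definition val_ideal (F : fieldType) (v : F -> int) := val_ge v 1.

Variables (k F E : fieldType) (c : {rmorphism k -> F}) (phi : {rmorphism F -> E}).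

Definition ramification_index (w : F -> int) (v : E -> int) (e : nat) : Prop :=
  (0 < e)%N /\ forall y, y != 0 -> v (phi y) = e%:Z * w y.

(* Every element of the residue field of v is a root of a separable polynomial
   over the residue field of w. Polynomials over the latter are represented by
   polynomials q over the valuation ring of w, and the coprimality of the
   reductions of q and q' is a Bezout identity modulo the maximal ideal of w. *)
Definition separable_residue_extension (w : F -> int) (v : E -> int) : Prop :=
  forall y : E, y \in val_ring v ->
    exists q a b : {poly F},
      [/\ [/\ q \is a polyOver (val_ring w), a \is a polyOver (val_ring w)
            & b \is a polyOver (val_ring w)],
          a * q + b * q^`() - 1 \is a polyOver (val_ideal w)
        & (map_poly phi q).[y] \in val_ideal v].

(* For the extension of function fields E/F over the constant field k: all the
   residue fields contain k, so they have the same characteristic as k, and e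
   is prime to the residue characteristic exponent iff e != 0 in k. *)
Definition tamely_ramified_ext : Prop :=
  forall (w : F -> int) (v : E -> int) (e : nat),
    discrete_valuation c w -> discrete_valuation (phi \o c) v ->
    ramification_index w v e ->
    e%:R != 0 :> k /\ separable_residue_extension w v.

End DiscreteValuations.

Notation ratfun K := {fraction {poly K}}.
Notation tofrac := FracField.tofrac.

Definition ratconst (K : fieldType) : {rmorphism K -> ratfun K} :=
  @tofrac {poly K} \o polyC.

Definition ratvar (K : fieldType) : ratfun K := tofrac 'X.

(* The value f(x), computed from an arbitrary representative of f, not
   necessarily in lowest terms. It is meaningful where the denominator does not
   vanish, in particular at every x that is transcendental over K. *)
Definition ratfun_eval (K E : fieldType) (i : {rmorphism K -> E})
    (f : ratfun K) (x : E) : E :=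
  (map_poly i \n_(repr f)).[x] / (map_poly i \d_(repr f)).[x].

Section RationalFunction.

(* Omega is a separable closure of K(t) through iota. *)
Variables (K Omega : fieldType) (iota : {rmorphism ratfun K -> Omega}).
Variable f : ratfun K.

Definition base_emb : {rmorphism K -> Omega} := iota \o ratconst K.

Definition geom_consts : fieldType := algclosure_in base_emb.

Definition geom_const_emb : {rmorphism K -> ratfun geom_consts} :=
  ratconst geom_consts \o algclosure_base base_emb.

(* With Kb the algebraic closure of K in Omega, phi is the Kb-embedding of Kb(t)
   into Kb(x) sending t to f(x). It is unique, and exists iff f is not
   constant; in particular a constant f is not tamely ramified. *)
Definition tamely_ramified : Prop :=
  exists phi : {rmorphism ratfun geom_consts -> ratfun geom_consts},
    [/\ forall a, phi (ratconst geom_consts a) = ratconst geom_consts a,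
        phi (ratvar geom_consts)
          = ratfun_eval geom_const_emb f (ratvar geom_consts)
      & tamely_ramified_ext (ratconst geom_consts) phi].

(* No spurious solution comes from a vanishing denominator: if x is algebraic
   over K, then so is every iterate computed here, which thus differs from t; if
   x is transcendental over K and f is not constant, all the iterates are
   transcendental and no denominator vanishes. *)
Definition backward_orbit : set Omega :=
  [set x | exists n : nat,
     iter n (ratfun_eval base_emb f) x = iota (ratvar K)]%classic.

Definition const_field_ext : fieldType :=
  algclosure_in (adjoin_base base_emb backward_orbit).

Definition const_field_ext_base : {rmorphism K -> const_field_ext} :=
  algclosure_base (adjoin_base base_emb backward_orbit).

End RationalFunction.

(* Main.v *)
Require Import Defs.
From HB Require Import structures.
From mathcomp Require Import all_fingroup all_boot all_order all_algebra.
From mathcomp Require Import separable cyclic.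
From mathcomp Require Import boolp classical_sets cardinality.
From mathcomp Require Import zify.

(* Let d be the degree of f. Tameness at infinity says that d is nonzero in K.
   The preimages of t under the iterates f^m, m <= n, embed into the field of
   Laurent series in s over K' = K(z), where z is a primitive d^n-th root of
   unity: send t to f^n(1/s); after clearing denominators, the reduction modulo
   s of f^m(Y) - f^m(w), where w = f^(n-m)(1/s) has a pole, becomes a multiple
   of Y^(d^m) - c, c != 0, which has simple roots in K', and Hensel's lemma
   lifts them. As K' is algebraically closed in its Laurent series field, the
   constant field extension F is contained in the union of the K(z).
   An automorphism of F acts on the elements of F that lie in K(z) through
   z |-> z^u for some u. A subgroup of index n contains all n!-th powers, and
   for k = n! the index of the k-th powers in a group U of units modulo d^m is
   the number of u in U with u^k = 1, which is at most d^k k, independently of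
   m. So the open subgroups of index n are unions of cosets of one subgroup of
   finite index. *)

Set Implicit Arguments.
Unset Strict Implicit.
Unset Printing Implicit Defensive.

Import GRing.Theory.
Local Open Scope ring_scope.

(** * Extending homomorphisms to a root of a polynomial *)

Definition splits (L : fieldType) (p : {poly L}) : Prop :=
  exists2 c, c != 0 & exists rs : seq L, p = c *: \prod_(r <- rs) ('X - r%:P).

Lemma splits_of_roots (L : fieldType) (p : {poly L}) (rs : seq L) :
  uniq rs -> all (root p) rs -> size p = (size rs).+1 -> splits p.
Proof.
move=> Urs rsP szp.
have p0 : p != 0 by rewrite -size_poly_eq0 szp.
exists (lead_coef p); first by rewrite lead_coef_eq0.
exists rs; apply: all_roots_prod_XsubC => //.
by rewrite uniq_rootsE.
Qed.

(** Let [q] be the minimal polynomial of [y]. Its image under [psi] divides the split polynomial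
    [map_poly psi G], so it has a root [r]; every [P] vanishing at [y] is a multiple of [q]. *)
Lemma common_root (E Om L : fieldType) (i : {rmorphism E -> Om})
    (psi : {rmorphism E -> L}) (y : Om) (G : {poly E}) :
  G != 0 -> root (map_poly i G) y -> splits (map_poly psi G) ->
  exists2 r, root (map_poly psi G) r &
    forall P, root (map_poly i P) y -> root (map_poly psi P) r.
Proof.
move=> G0 Gy [c c0 [rs Grs]].
pose good n := `[< exists2 q : {poly E}, size q = n.+1 & root (map_poly i q) y >].
have exg : exists n, good n.
  exists (size G).-1; apply/asboolP; exists G => //.
  by rewrite prednK // size_poly_gt0.
case: (ex_minnP exg) => n /asboolP[q szq qy] qmin.
have q0 : q != 0 by rewrite -size_poly_eq0 szq.
have qdvd P : root (map_poly i P) y -> q %| P.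
  move=> Py; apply/modp_eq0P/eqP; apply: contraT => r0.
  have ry : root (map_poly i (P %% q)) y.
    move: Py; rewrite {1}(divp_eq P q) rmorphD rmorphM /= /root hornerD hornerM.
    by move/rootP: qy => ->; rewrite mulr0 add0r.
  have := qmin (size (P %% q)).-1.
  have -> : good (size (P %% q)).-1.
    by apply/asboolP; exists (P %% q) => //; rewrite prednK // size_poly_gt0.
  move=> /(_ isT); rewrite leqNgt => /negP[].
  by rewrite -ltnS -szq prednK ?size_poly_gt0 // ltn_modp.
have : map_poly psi q %| \prod_(r <- rs) ('X - r%:P).
  rewrite -(dvdpZr _ _ c0) -Grs dvdp_map; exact: qdvd.
case/dvdp_prod_XsubC => m qE.
have [r rq] : exists r, root (map_poly psi q) r.
  case: (mask m rs) qE => [|r s] qE; last first.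
    by exists r; rewrite (eqp_root qE) big_cons rootM root_XsubC eqxx.
  move: qE; rewrite big_nil => /eqp_size; rewrite size_map_poly szq size_poly1.
  move=> [n0]; move: qy q0; rewrite (@size1_polyC _ q) ?szq ?n0 //.
  by rewrite map_polyC rootC fmorph_eq0 polyC_eq0 => ->.
have qP P : root (map_poly i P) y -> root (map_poly psi P) r.
  move/qdvd/dvdpP => [P' ->].
  by rewrite rmorphM rootM rq orbT.
by exists r; [apply: qP | ].
Qed.

Lemma algebraic_horner (K L : fieldType) (i : {rmorphism K -> L}) (P : {poly K}) y :
  algebraicOver i y -> algebraicOver i (map_poly i P).[y].
Proof.
move=> /integral_algebraic ay; apply/integral_algebraic.
apply: integral_horner => //; apply/integral_poly => n.
by rewrite coef_map; apply/integral_algebraic/algebraic_id.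
Qed.

(* If [w P w = - P0] with [P0] a nonzero constant then [w^-1 = - P w / P0]. *)
Lemma algebraic_inv_horner (K L : fieldType) (i : {rmorphism K -> L}) (w : L) :
  algebraicOver i w -> exists P, w^-1 = (map_poly i P).[w].
Proof.
have [->|w0] := eqVneq w 0.
  by exists 0; rewrite invr0 rmorph0 horner0.
case=> G G0 Gw.
(* As [w] is nonzero, the factors ['X] of [G] can be removed, which leaves [Q] with a nonzero
   constant coefficient. *)
have [m [Q Q0 GE]] := multiplicity_XsubC G 0.
rewrite G0 /= in Q0.
have Qw : (map_poly i Q).[w] = 0.
  move: Gw; rewrite GE rmorphM rootM => /orP[/rootP //|].
  by rewrite rmorphXn /= map_polyXsubC rmorph0 subr0 rootE hornerXn expf_eq0 (negPf w0) andbF.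
have [Q' QE] : exists Q', Q = Q' * 'X + (Q.[0])%:P.
  have /factor_theorem[Q' QE] : root (Q - Q.[0]%:P) 0 by rewrite /root !hornerE subrr.
  by exists Q'; rewrite -{1}(subrK Q.[0]%:P Q) QE subr0.
exists (- (Q.[0])^-1 *: Q').
rewrite linearZ /= hornerZ.
move: Qw; rewrite {1}QE rmorphD rmorphM /= map_polyX map_polyC !hornerE /=.
move/eqP; rewrite addr_eq0 => /eqP QwE.
have iQ0 : i Q.[0] != 0 by rewrite fmorph_eq0; apply: contra Q0.
apply: (mulIf w0); rewrite mulVf // -mulrA QwE rmorphN fmorphV mulrNN mulVf //.
Qed.

(** The values [P(y)] form a subfield: [Q(y)] is again algebraic, so its inverse is a polynomial in
    [Q(y)]. *)
Lemma in_adjoin1P (K L : fieldType) (i : {rmorphism K -> L}) (y : L) :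
  algebraicOver i y ->
  forall x, x \in in_adjoin i [set y]%classic -> exists P, x = (map_poly i P).[y].
Proof.
move=> ay x.
pose S : {pred L} := fun x => `[< exists P, x = (map_poly i P).[y] >].
have Sdiv : divring_closed S.
  split; first by apply/asboolP; exists 1; rewrite rmorph1 hornerC.
    move=> _ _ /asboolP[P ->] /asboolP[Q ->]; apply/asboolP; exists (P - Q).
    by rewrite rmorphB !hornerE.
  move=> _ _ /asboolP[P ->] /asboolP[Q ->]; apply/asboolP.
  have [R ->] := algebraic_inv_horner (algebraic_horner Q ay).
  by exists (P * (R \Po Q)); rewrite rmorphM hornerM /= map_comp_poly horner_comp.
pose S' : divringClosed L := HB.pack S (GRing.isDivringClosed.Build L S Sdiv).
move/asboolP/(_ S') => H; apply/asboolP; apply: H => [a|_ ->].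
  by apply/asboolP; exists a%:P; rewrite map_polyC hornerC.
by apply/asboolP; exists 'X; rewrite map_polyX hornerX.
Qed.

(** On [E' = E(y)] the extension sends [P(y)] to [P(r)]. It is well defined because [r] satisfies
    every polynomial relation of [y]. *)
Lemma hom_extend (E Om L : fieldType) (i : {rmorphism E -> Om})
    (psi : {rmorphism E -> L}) (y : Om) (G : {poly E}) :
  G != 0 -> root (map_poly i G) y -> splits (map_poly psi G) ->
  exists (E' : fieldType) (e : {rmorphism E -> E'}) (i' : {rmorphism E' -> Om})
    (psi' : {rmorphism E' -> L}),
    [/\ i' \o e =1 i, psi' \o e =1 psi & exists y', i' y' = y].
Proof.
move=> G0 Gy Gs; have [r _ rP] := common_root G0 Gy Gs.
have ay : algebraicOver i y by exists G.
pose E' := adjoin i [set y]%classic.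
pose i' : {rmorphism E' -> Om} := (val : E' -> Om).
have [c cV] := choice (fun x : E' => in_adjoin1P ay (valP x)).
have cP x : i' x = (map_poly i (c x)).[y] by apply: cV.
pose psi' (x : E') := (map_poly psi (c x)).[r].
have psiE x P : i' x = (map_poly i P).[y] -> psi' x = (map_poly psi P).[r].
  rewrite cP => xP; apply/eqP; rewrite -subr_eq0 -hornerN -hornerD -rmorphB.
  by apply: rP; rewrite /root rmorphB hornerD hornerN xP subrr.
have psiB : zmod_morphism psi'.
  move=> a b; rewrite (psiE _ (c a - c b)) ?raddfB ?hornerD ?hornerN //.
  by rewrite -!cP.
have psiM : monoid_morphism psi'.
  split=> [|a b]; first by rewrite (psiE _ 1) ?rmorph1 ?hornerC.
  rewrite (psiE _ (c a * c b)) ?[map_poly _ _]rmorphM ?hornerM //.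
  by rewrite -!cP ?rmorphM.
pose psi'' : {rmorphism E' -> L} := HB.pack psi'
  (GRing.isZmodMorphism.Build _ _ _ psiB) (GRing.isMonoidMorphism.Build _ _ _ psiM).
exists E', (adjoin_base i [set y]%classic), i', psi''; split=> //.
  by move=> a; rewrite /= (psiE _ a%:P) map_polyC hornerC.
have yE : y \in in_adjoin i [set y]%classic by apply/asboolP => S _; apply.
by exists (Subfield yE).
Qed.

(** * Formal power series *)

Definition powser (k : fieldType) : Type := nat -> k.

Section PowerSeriesRing.
Variable k : fieldType.
Notation R := (powser k).
Implicit Types f g h : R.

HB.instance Definition _ := gen_eqMixin R.
HB.instance Definition _ := gen_choiceMixin R.

Lemma psP f g : f =1 g -> f = g. Proof. exact: funext. Qed.

Definition ps_add f g : R := fun n => f n + g n.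
Definition ps_opp f : R := fun n => - f n.
Definition ps_zero : R := fun=> 0.
Definition ps_mul f g : R := fun n => \sum_(i < n.+1) f i * g (n - i)%N.
Definition ps_const (c : k) : R := fun n => if n is 0 then c else 0.

Fact ps_addA : associative ps_add.
Proof. by move=> f g h; apply: psP => n; apply: addrA. Qed.
Fact ps_addC : commutative ps_add.
Proof. by move=> f g; apply: psP => n; apply: addrC. Qed.
Fact ps_add0 : left_id ps_zero ps_add.
Proof. by move=> f; apply: psP => n; apply: add0r. Qed.
Fact ps_addN : left_inverse ps_zero ps_opp ps_add.
Proof. by move=> f; apply: psP => n; apply: addNr. Qed.

HB.instance Definition _ := GRing.isZmodule.Build R ps_addA ps_addC ps_add0 ps_addN.

(** The coefficients of a product up to degree [m] depend only on truncations, so associativity and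
    commutativity are inherited from [{poly k}]. *)
Definition trunc m f : {poly k} := \poly_(i < m.+1) f i.

Lemma coef_trunc m f i : (i <= m)%N -> (trunc m f)`_i = f i.
Proof. by move=> im; rewrite coef_poly ltnS im. Qed.

Lemma ps_mul_trunc m f g n : (n <= m)%N -> ps_mul f g n = (trunc m f * trunc m g)`_n.
Proof.
move=> nm; rewrite coefM; apply: eq_bigr => i _.
by rewrite !coef_trunc // (leq_trans _ nm) ?leq_subr // -ltnS.
Qed.

Lemma coef_trunc_mul m f g n :
  (n <= m)%N -> (trunc m (ps_mul f g))`_n = (trunc m f * trunc m g)`_n.
Proof. by move=> nm; rewrite coef_trunc // (ps_mul_trunc _ _ nm). Qed.

Fact ps_mulA : associative ps_mul.
Proof.
move=> f g h; apply: psP => n; rewrite !(@ps_mul_trunc n) //.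
transitivity (trunc n f * (trunc n g * trunc n h))`_n.
  rewrite coefM [RHS]coefM; apply: eq_bigr => i _.
  by rewrite coef_trunc_mul // leq_subr.
rewrite mulrA coefM [RHS]coefM; apply: eq_bigr => i _.
by rewrite coef_trunc_mul // -ltnS.
Qed.
Fact ps_mulC : commutative ps_mul.
Proof. by move=> f g; apply: psP => n; rewrite !(@ps_mul_trunc n) // mulrC. Qed.

Lemma ps_mul_const c f n : ps_mul (ps_const c) f n = c * f n.
Proof.
rewrite /ps_mul big_ord_recl big1 ?addr0 ?subn0 // => i _.
by rewrite mul0r.
Qed.

Fact ps_mul1 : left_id (ps_const 1) ps_mul.
Proof. by move=> f; apply: psP => n; rewrite ps_mul_const mul1r. Qed.
Fact ps_mulDl : left_distributive ps_mul ps_add.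
Proof.
move=> f g h; apply: psP => n; rewrite /ps_mul /ps_add -big_split.
by apply: eq_bigr => i _; apply: mulrDl.
Qed.
Fact ps_1neq0 : ps_const 1 != ps_zero.
Proof. by apply/eqP => /(congr1 (@^~ 0%N))/eqP; rewrite oner_eq0. Qed.

HB.instance Definition _ :=
  GRing.Zmodule_isComNzRing.Build R ps_mulA ps_mulC ps_mul1 ps_mulDl ps_1neq0.

(** Invertibility is taken as the mere existence of an inverse; that a nonzero constant coefficient
    suffices follows from Hensel's lemma, in [ps_res_unit]. *)
Definition ps_unit : pred R := fun f => `[< exists g, g * f = 1 >].
Definition ps_inv f : R :=
  if pselect (exists g, g * f = 1) is left fU then projT1 (cid fU) else f.

Fact ps_mulVf : {in ps_unit, left_inverse 1 ps_inv *%R}.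
Proof.
move=> f /asboolP fU; rewrite /ps_inv; case: pselect => // ?.
by case: cid.
Qed.
Fact ps_unitP f g : g * f = 1 -> ps_unit f.
Proof. by move=> fg; apply/asboolP; exists g. Qed.
Fact ps_inv_out : {in [predC ps_unit], ps_inv =1 id}.
Proof. by move=> f /asboolP fU; rewrite /ps_inv; case: pselect. Qed.

HB.instance Definition _ :=
  GRing.ComNzRing_hasMulInverse.Build R ps_mulVf ps_unitP ps_inv_out.

(** The filtration by powers of the variable; it stands in for the valuation and needs no convention
    at [0]. *)
Definition low m f : Prop := forall n, (n < m)%N -> f n = 0.

Lemma ps_coefD f g n : (f + g) n = f n + g n. Proof. by []. Qed.
Lemma ps_coefB f g n : (f - g) n = f n - g n. Proof. by []. Qed.
Lemma ps_coefM f g n : (f * g) n = \sum_(i < n.+1) f i * g (n - i)%N.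
Proof. by []. Qed.

Lemma lowM a b f g : low a f -> low b g -> low (a + b) (f * g).
Proof.
move=> fa gb n nab; rewrite ps_coefM big1 // => i _.
have [ia|ai] := ltnP i a; first by rewrite fa ?mul0r.
have le_in : (i <= n)%N by rewrite -ltnS.
by rewrite gb ?mulr0 // ltn_subLR // (leq_trans nab) ?leq_add2r.
Qed.

Lemma lowD a f g : low a f -> low a g -> low a (f + g).
Proof. by move=> fa ga n na; rewrite ps_coefD fa ?ga ?addr0. Qed.

Lemma lowMr a f g : low a f -> low a (f * g).
Proof. by move=> fa; rewrite -[a]addn0; apply: lowM. Qed.

Lemma low_eq0 f : (forall a, low a f) -> f = 0.
Proof. by move=> lf; apply: psP => n; apply: (lf n.+1). Qed.

Lemma ps_lead f : f != 0 -> exists2 a, f a != 0 & low a f.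
Proof.
move=> f0; have ex : exists a, f a != 0.
  apply: contrapT => /forallNP fz; move/eqP: f0; apply; apply: psP => n.
  by apply: contrapT => /eqP; apply: fz.
case: (ex_minnP ex) => a fa amin; exists a => // n na.
by apply/eqP; apply: contraTT na => /amin; rewrite -leqNgt.
Qed.

(** Only the lowest terms of [f] and [g], of degrees [a] and [b], contribute to the coefficient of
    degree [a + b] of the product. *)
Fact ps_integral : GRing.integral_domain_axiom R.
Proof.
move=> f g fg0; apply/norP => -[/ps_lead[a fa la] /ps_lead[b gb lb]].
have: (f * g) (a + b)%N = 0 by rewrite fg0.
rewrite ps_coefM (bigD1 (inord a)) //= inordK ?ltnS ?leq_addr // addKn.
rewrite big1 => [/eqP|i ia]; first by rewrite addr0 mulf_eq0 (negPf fa) (negPf gb).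
have [i_a|a_i] := ltnP i a; first by rewrite la ?mul0r.
have {}ia : (i : nat) != a.
  by apply: contra ia => /eqP ia; rewrite -val_eqE /= inordK ?ia // ltnS leq_addr.
have le_in : (i <= a + b)%N by rewrite -ltnS.
by rewrite lb ?mulr0 // ltn_subLR // ltn_add2r ltn_neqAle eq_sym ia.
Qed.

HB.instance Definition _ := GRing.ComUnitRing_isIntegral.Build R ps_integral.

Fact ps_const_zmod : zmod_morphism ps_const.
Proof. by move=> a b; apply: psP => -[|n] //=; rewrite ps_coefB subrr. Qed.
Fact ps_const_monoid : monoid_morphism ps_const.
Proof.
split=> // a b; apply: psP => n.
rewrite [RHS]ps_mul_const; case: n => //= n; by rewrite mulr0.
Qed.
HB.instance Definition _ := GRing.isZmodMorphism.Build _ _ ps_const ps_const_zmod.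
HB.instance Definition _ := GRing.isMonoidMorphism.Build _ _ ps_const ps_const_monoid.

Definition ps_res f : k := f 0%N.
Fact ps_res_zmod : zmod_morphism ps_res. Proof. by []. Qed.
Fact ps_res_monoid : monoid_morphism ps_res.
Proof. by split=> // f g; rewrite /ps_res ps_coefM big_ord1. Qed.
HB.instance Definition _ := GRing.isZmodMorphism.Build _ _ ps_res ps_res_zmod.
HB.instance Definition _ := GRing.isMonoidMorphism.Build _ _ ps_res ps_res_monoid.

Lemma ps_constK : cancel ps_const ps_res. Proof. by []. Qed.

Definition ps_X : R := fun n => (n == 1%N)%:R.

Lemma ps_mulX f n : (ps_X * f) n = if n is m.+1 then f m else 0.
Proof.
rewrite ps_coefM; case: n => [|n]; first by rewrite big_ord1 mul0r.
rewrite 2!big_ord_recl big1 ?addr0 ?mul0r ?add0r ?mul1r ?subn1 //= => i _.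
by rewrite mul0r.
Qed.

Lemma ps_mulXn m f n : (ps_X ^+ m * f) n = if (n < m)%N then 0 else f (n - m)%N.
Proof.
elim: m f n => [|m IH] f n; first by rewrite expr0 mul1r subn0.
by rewrite exprS -mulrA ps_mulX; case: n => [//|n]; rewrite IH.
Qed.

Lemma ps_X_neq0 : ps_X != 0.
Proof. by apply/eqP => /(congr1 (@^~ 1%N))/eqP; rewrite oner_eq0. Qed.

Lemma low_divX a f : low a f -> exists g, f = ps_X ^+ a * g.
Proof.
move=> fa; exists (fun n => f (n + a)%N); apply: psP => n.
rewrite ps_mulXn; case: ltnP => [/fa //|an]; by rewrite subnK.
Qed.

End PowerSeriesRing.

Arguments ps_const {k}.
Arguments ps_res {k}.
Arguments ps_X {k}.

(** The Taylor expansion with divided derivatives, hence free of denominators and valid in every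
    characteristic. *)
Lemma horner_taylor2 (S : comNzRingType) (q : {poly S}) (x h : S) :
  exists r, q.[x + h] = q.[x] + q^`().[x] * h + h * (h * r).
Proof.
exists (\sum_(i < size q) q^`N(i.+2).[x] * h ^+ i).
rewrite (@nderiv_taylor_wide _ (size q).+2 _ _ _ (mulrC x h)); last by rewrite leqW.
rewrite 2!big_ord_recl nderivn0 nderivn1 expr0 mulr1 expr1 -addrA; congr (_ + (_ + _)).
rewrite !mulr_sumr; apply: eq_bigr => i _.
by rewrite /= /bump /= !add1n !exprS mulrCA; congr (_ * _); rewrite mulrCA.
Qed.

(** Newton's iteration with the constant slope [c], so that only an element of [k] is inverted. The
    order of the value of [q] at [u n] grows by at least one at each step. *)
Lemma hensel (k : fieldType) (q : {poly powser k}) (x0 : k) :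
  (map_poly ps_res q).[x0] = 0 -> (map_poly ps_res q)^`().[x0] != 0 ->
  exists2 x : powser k, ps_res x = x0 & q.[x] = 0.
Proof.
move=> q0 q'0; set c := (map_poly ps_res q)^`().[x0] in q'0.
pose u n := iter n (fun x => x - ps_const c^-1 * q.[x]) (ps_const x0).
have uS n : u n.+1 = u n - ps_const c^-1 * q.[u n] by [].
have res_q x : ps_res x = x0 -> ps_res q.[x] = 0.
  by move=> xx0; rewrite -horner_map /= xx0.
have res_u n : ps_res (u n) = x0.
  elim: n => [|n IH]; first exact: ps_constK.
  by rewrite uS rmorphB rmorphM /= res_q // mulr0 subr0.
have low1 f : ps_res f = 0 -> low 1 f by move=> f0 [].
have low_u n : low n.+1 q.[u n].
  elim: n => [|n IH]; first exact/low1/res_q.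
  rewrite uS; set y := q.[u n]; set x := u n.
  have [r ->] := horner_taylor2 q x (- (ps_const c^-1 * y)).
  (* The new value is the old value [y] times a factor of positive order: the derivative of [q] at
     [x] reduces to [c], and [y] reduces to [0]. *)
  have -> : q.[x] + q^`().[x] * - (ps_const c^-1 * y)
      + - (ps_const c^-1 * y) * (- (ps_const c^-1 * y) * r)
    = y * ((1 - q^`().[x] * ps_const c^-1) + y * (ps_const c^-1 * (ps_const c^-1 * r))).
    rewrite mulrDr mulrBr mulr1 !(mulrN, mulNr) opprK; congr (_ - _ + _).
      by rewrite mulrA mulrC.
    by rewrite !mulrA [LHS](ACl (2*4*1*3*5)).
  rewrite -addn1; apply: lowM => //; apply: lowD; last first.
    by apply/lowMr/low1/res_q/res_u.
  apply: low1; rewrite rmorphB rmorphM /= -horner_map /= ps_constK -deriv_map res_u.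
  by rewrite -/c mulfV // rmorph1 subrr.
(* The coefficient of degree [n] is stationary from step [n] on, so the diagonal is the limit of the
   iteration. *)
pose x : powser k := fun n => u n n.
have ux n m : (n <= m)%N -> u m n = x n.
  elim: m => [|m IH]; first by rewrite leqn0 => /eqP->.
  rewrite leq_eqVlt => /predU1P[-> //|nm]; rewrite -IH // uS ps_coefB.
  by rewrite mulrC (lowMr _ (low_u m)) ?subr0 //.
have low_x n : low n.+1 (x - u n).
  by move=> m mn; rewrite ps_coefB ux ?subrr.
exists x; first by rewrite -(res_u 0%N).
(* For every [a], both [q.[u a]] and [x - u a] have order at least [a], hence so does [q.[x]]. *)
apply: low_eq0 => a n na.
have [r E] := horner_taylor2 q (u a) (x - u a).
rewrite addrC subrK in E; rewrite E.
have lx : low a (x - u a) by move=> m ma; apply: low_x; apply: ltnW.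
apply: (_ : low a _) na; apply: lowD; last exact: lowMr.
apply: lowD; first by move=> m ma; apply: low_u; apply: ltnW.
by rewrite mulrC; apply: lowMr.
Qed.

(** The inverse is the root of [f *: 'X - 1] given by Hensel's lemma; the reduction is linear with
    nonzero slope. *)
Lemma ps_res_unit (k : fieldType) (f : powser k) :
  ps_res f != 0 -> f \is a GRing.unit.
Proof.
move=> f0; have [||g _ /eqP] := @hensel k (f *: 'X - 1) (ps_res f)^-1.
- by rewrite rmorphB /= map_polyZ map_polyX rmorph1 !hornerE mulfV ?subrr.
- by rewrite rmorphB /= map_polyZ map_polyX rmorph1 derivB derivZ derivX !hornerE derivC horner0 subr0.
rewrite !hornerE subr_eq0 => /eqP fg.
by apply/unitrP; exists g; rewrite mulrC.
Qed.

(** * Laurent series as fractions of power series *)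

Lemma frac_numden (R : idomainType) (z : {fraction R}) :
  z = tofrac \n_(repr z) / tofrac \d_(repr z).
Proof.
have d0 : tofrac \d_(repr z) != 0 by rewrite tofrac_eq0 denom_ratioP.
apply: (mulIf d0); rewrite divfK //.
rewrite -{1}[z]reprK.
unlock FracField.tofrac; rewrite -[LHS]FracField.pi_mul.
apply/eqmodP; rewrite /= FracField.equivfE /FracField.mulf !(numden_Ratio, mulr1) ?mulr1 ?oner_neq0 ?denom_ratioP //.
by rewrite mulrC.
Qed.

(** Power series form a valuation ring: a nonzero series is a power of the variable times a unit, so
    of two such series the one of lower order divides the other. *)
Lemma frac_ps_val (k : fieldType) (z : {fraction powser k}) :
  exists r : powser k, z = tofrac r \/ z^-1 = tofrac r.
Proof.
rewrite (frac_numden z); set a := \n_ _; set b := \d_ _.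
have [->|a0] := eqVneq a 0; first by exists 0; left; rewrite !rmorph0 mul0r.
have b0 : b != 0 by apply: denom_ratioP.
have wlog_div (f g : powser k) n m : f n != 0 -> low n f -> g m != 0 -> low m g ->
    (n <= m)%N -> exists r, tofrac g / tofrac f = tofrac r.
  move=> fn /low_divX[f' fE] gm /low_divX[g' gE] nm.
  have fU : f' \is a GRing.unit.
    by apply: ps_res_unit; move: fn; rewrite fE ps_mulXn ltnn subnn.
  exists (ps_X ^+ (m - n) * g' / f').
  have f0 : tofrac f != 0 by rewrite tofrac_eq0; apply: contraNneq fn => ->.
  apply: (mulIf f0); rewrite divfK // -rmorphM; congr tofrac.
  by rewrite fE gE (mulrC (ps_X ^+ n)) mulrA divrK // mulrAC -exprD subnK.
have [n an la] := ps_lead a0; have [m bm lb] := ps_lead b0.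
have [mn|/ltnW nm] := leqP m n.
  by have [r ?] := wlog_div _ _ _ _ bm lb an la mn; exists r; left.
by have [r ?] := wlog_div _ _ _ _ an la bm lb nm; exists r; right; rewrite invf_div.
Qed.

Definition laurent_const (k : fieldType) : {rmorphism k -> {fraction powser k}} :=
  @FracField.tofrac (powser k) \o @ps_const k.

(** Up to inversion [z] is a power series [r]. If [w], which is [r] minus its constant coefficient,
    were nonzero, then its inverse, a polynomial in [w] over [k], would also be a power series;
    reducing the product of the two gives [0 = 1]. *)
Lemma laurent_algebraic (k : fieldType) (z : {fraction powser k}) :
  algebraicOver (laurent_const k) z -> exists c, z = laurent_const k c.
Proof.
wlog [r ->] : z / exists r : powser k, z = tofrac r => [IH az|].
  have [r [zr|zr]] := frac_ps_val z; first by apply: IH => //; exists r.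
  have [||c zc] := IH z^-1; [by exists r | exact: algebraic_inv | ].
  by exists c^-1; rewrite fmorphV -zc invrK.
move=> ar; exists (ps_res r); apply/eqP; rewrite -subr_eq0; apply: contraT => z0.
set w := _ - _ in z0.
have aw : algebraicOver (laurent_const k) w.
  exact: (algebraic_sub ar (algebraic_id _ _)).
have wE : w = tofrac (r - ps_const (ps_res r)) by rewrite rmorphB.
have [P PE] := algebraic_inv_horner aw.
move: (divff z0); rewrite PE wE map_poly_comp horner_map -rmorphM -(rmorph1 (@tofrac _)) => /eqP.
rewrite tofrac_eq => /eqP/(congr1 ps_res).
by rewrite rmorphM rmorphB /= ps_constK subrr mul0r rmorph1 => /esym/eqP; rewrite oner_eq0.
Qed.

(** * The degree of a tame polynomial *)

(** The chosen representative of [p] need not be reduced: its numerator is [p] times its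
    denominator, which cancels where it does not vanish. *)
Lemma ratfun_eval_poly (K E : fieldType) (i : {rmorphism K -> E}) (p : {poly K}) (x : E) :
  (map_poly i \d_(repr (tofrac p))).[x] != 0 ->
  ratfun_eval i (tofrac p) x = (map_poly i p).[x].
Proof.
move=> d0; rewrite /ratfun_eval; set z := repr _ in d0 *.
have zd0 : tofrac \d_z != 0 by rewrite tofrac_eq0 denom_ratioP.
have -> : \n_z = p * \d_z.
  apply/eqP; rewrite -tofrac_eq rmorphM /=.
  by rewrite [X in _ == X * _](frac_numden (tofrac p)) -/z divfK.
by rewrite rmorphM hornerM mulfK.
Qed.

Section ValuationAtInfinity.
Variable k : fieldType.
Implicit Types (n d : {poly k}) (x y z : ratfun k).

(** The order at infinity. The excess of [size] over the degree cancels in the difference. *)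
Definition val_infty z : int := (size \d_(repr z))%:Z - (size \n_(repr z))%:Z.

Lemma val_inftyE n d : n != 0 -> d != 0 ->
  val_infty (tofrac n / tofrac d) = (size d)%:Z - (size n)%:Z.
Proof.
move=> n0 d0; set z := _ / _; rewrite /val_infty.
have z0 : z != 0 by rewrite mulf_neq0 ?invr_eq0 ?tofrac_eq0.
have d'0 : \d_(repr z) != 0 by apply: denom_ratioP.
have n'0 : \n_(repr z) != 0.
  by apply: contraNneq z0; rewrite {2}(frac_numden z) => ->; rewrite rmorph0 mul0r.
have : n * \d_(repr z) = \n_(repr z) * d.
  apply/eqP; rewrite -tofrac_eq !rmorphM /= -eqr_div ?tofrac_eq0 //.
  by rewrite -frac_numden.
move/(congr1 (fun p : {poly k} => (size p)%:Z)).
rewrite /= !size_mul //.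
move: n0 d0 d'0 n'0; rewrite -!size_poly_gt0.
move: (size n) (size d) (size \d_(repr z)) (size \n_(repr z)) => a b c e.
lia.
Qed.

Lemma frac_neq0P z : z != 0 ->
  exists n d, [/\ n != 0, d != 0 & z = tofrac n / tofrac d].
Proof.
move=> z0; exists \n_(repr z), \d_(repr z); split; [|exact: denom_ratioP|exact: frac_numden].
by apply: contraNneq z0; rewrite {2}(frac_numden z) => ->; rewrite rmorph0 mul0r.
Qed.

Lemma val_infty_discrete : discrete_valuation (ratconst k) val_infty.
Proof.
split.
- move=> _ _ /frac_neq0P[n [d [n0 d0 ->]]] /frac_neq0P[n' [d' [n'0 d'0 ->]]].
  rewrite mulf_div -!rmorphM !val_inftyE ?mulf_neq0 // !size_mul //.
  move: n0 d0 n'0 d'0; rewrite -!size_poly_gt0.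
  move: (size n) (size d) (size n') (size d') => a b a' b'; lia.
- move=> _ _ /frac_neq0P[n [d [n0 d0 ->]]] /frac_neq0P[n' [d' [n'0 d'0 ->]]].
  rewrite addf_div ?tofrac_eq0 // -!rmorphM -rmorphD => xy0.
  rewrite !val_inftyE ?mulf_neq0 //; last first.
    by apply: contraNneq xy0 => ->; rewrite rmorph0 mul0r.
  have := size_polyD (n * d') (n' * d); rewrite !size_mul //.
  move: n0 d0 n'0 d'0; rewrite -!size_poly_gt0.
  move: (size n) (size d) (size n') (size d') (size (n * d' + n' * d)%R) => a b a' b' c; lia.
- exists (tofrac 1 / tofrac 'X).
    by rewrite mulf_neq0 ?invr_eq0 ?tofrac_eq0 ?oner_eq0 ?polyX_eq0.
  by rewrite val_inftyE ?oner_neq0 ?polyX_eq0 // size_poly1 size_polyX.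
- move=> a a0; have -> : ratconst k a = tofrac a%:P / tofrac 1 by rewrite rmorph1 divr1.
  by rewrite val_inftyE ?oner_neq0 ?polyC_eq0 // size_poly1 size_polyC a0.
Qed.

(** The place at infinity lies over itself with ramification index the degree of [q], since
    composing with [q] multiplies degrees by it. Tameness at this place is the second claim. *)
Lemma tame_degree (phi : {rmorphism ratfun k -> ratfun k}) (q : {poly k}) :
    (forall a, phi (ratconst k a) = ratconst k a) -> phi (ratvar k) = tofrac q ->
    tamely_ramified_ext (ratconst k) phi ->
  (0 < (size q).-1)%N /\ ((size q).-1)%:R != 0 :> k.
Proof.
move=> phic phiX tame.
have phiE P : phi (tofrac P) = tofrac (P \Po q).
  elim/poly_ind: P => [|P c IH]; first by rewrite comp_poly0 !rmorph0.
  rewrite rmorphD rmorphM /= rmorphD rmorphM IH -/(ratvar k) phiX /=.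
  by rewrite -/(ratconst k c) phic comp_polyD comp_polyM comp_polyX comp_polyC rmorphD rmorphM.
have dgt0 : (0 < (size q).-1)%N.
  rewrite lt0n; apply/eqP => q0.
  (* If [q] were constant, [phi] would kill a nonzero linear polynomial. *)
  have : phi (tofrac ('X - (q`_0)%:P)) = 0.
    rewrite phiE comp_polyB comp_polyX comp_polyC [X in X - _](@size1_polyC _ q) ?subrr ?rmorph0 //.
    by case: (size q) q0 => [|[]].
  move/eqP; rewrite fmorph_eq0 tofrac_eq0 => /eqP/(congr1 (fun p : {poly k} => size p)).
  by rewrite size_XsubC size_poly0.
split=> //.
have [] // := tame val_infty val_infty (size q).-1 val_infty_discrete.
  case: val_infty_discrete => vM vD v1 vc; split=> // a a0.
  by rewrite /= phic vc.
split=> // _ /frac_neq0P[n [d [n0 d0 ->]]].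
have comp0 P : P != 0 -> P \Po q != 0.
  by move=> P0; rewrite comp_poly_eq0 // -ltn_predRL.
rewrite rmorphM fmorphV !phiE !val_inftyE ?comp0 //.
have := size_comp_poly n q; have := size_comp_poly d q.
move: n0 d0 (comp0 _ n0) (comp0 _ d0); rewrite -!size_poly_gt0.
move: (size n) (size d) (size (n \Po q)) (size (d \Po q)) (size q).-1 => a b a' b' c.
nia.
Qed.
End ValuationAtInfinity.

(** * Laurent expansions at infinity *)

(** Only separable polynomials are known to have roots, so roots are split off one by one, the
    cofactor staying separable and coprime to the removed factor. This yields [N] distinct roots of
    ['X^N - 1], among which one is primitive. *)
Lemma exists_prim_root (L : fieldType) (N : nat) :
    (forall p : {poly L}, separable_poly p -> (1 < size p)%N -> exists x, root p x) ->
  (0 < N)%N -> N%:R != 0 :> L -> exists z : L, N.-primitive_root z.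
Proof.
move=> Lcl N0 NL.
have split_sep n (q : {poly L}) : size q = n.+1 -> separable_poly q ->
    exists rs : seq L, [/\ uniq rs, all (root q) rs & size rs = n].
  elim: n q => [|n IH] q szq sq; first by exists [::].
  have [|x qx] := Lcl q sq; first by rewrite szq.
  have /factor_theorem[q' qE] := qx.
  have q0 : q' != 0 by apply: contraPneq szq => q'0; rewrite qE q'0 mul0r size_poly0.
  move: sq; rewrite qE separable_mul => /and3P[sq' _ cop].
  have [|rs [Urs rsq' szrs]] := IH q' _ sq'.
    by move: szq; rewrite qE size_Mmonic ?monicXsubC // size_XsubC addn2 => -[].
  exists (x :: rs); split; last by rewrite /= szrs.
  - rewrite /= Urs andbT; apply: contraTN isT => /(allP rsq') q'x.
    by move: cop; rewrite coprimep_XsubC q'x.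
  - rewrite /= rootM root_XsubC eqxx orbT; apply/allP => y /(allP rsq').
    by rewrite rootM => ->.
have [||rs [Urs rsN szrs]] := split_sep N ('X^N - 1).
- by rewrite size_XnsubC.
(* Minus the polynomial plus [N^-1 'X] times its derivative is [1]. *)
- rewrite unlock; apply/Bezout_eq1_coprimepP; exists (-1, N%:R^-1 *: 'X) => /=.
  rewrite derivB derivC subr0 derivXn -scaler_nat -scalerAl -scalerAr scalerA mulVf //.
  by rewrite scale1r -exprS prednK // mulN1r opprB subrK.
have /hasP[z _ zN] : has N.-primitive_root rs.
  apply: has_prim_root => //; last by rewrite szrs.
by exists z.
Qed.

Lemma frac_hom (R : idomainType) (E : fieldType) (h : {rmorphism R -> E}) :
  injective h ->
  exists psi : {rmorphism {fraction R} -> E}, forall r, psi (tofrac r) = h r.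
Proof.
move=> hI.
have h0 r : (h r == 0) = (r == 0) by rewrite -(rmorph0 h) (inj_eq hI).
pose psi (z : {fraction R}) := h \n_(repr z) / h \d_(repr z).
have psiE n d : d != 0 -> psi (tofrac n / tofrac d) = h n / h d.
  move=> d0; set z := _ / _; apply/eqP.
  have d'0 : \d_(repr z) != 0 by rewrite denom_ratioP.
  rewrite eqr_div ?h0 // -!rmorphM (inj_eq hI) -tofrac_eq !rmorphM /=.
  by rewrite -eqr_div ?tofrac_eq0 // -frac_numden.
have psiB : zmod_morphism psi.
  move=> y z; rewrite (frac_numden y) (frac_numden z).
  set n := \n_ _; set d := \d_ _; set n' := \n_ _; set d' := \d_ _.
  have d0 : d != 0 by rewrite denom_ratioP.
  have d'0 : d' != 0 by rewrite denom_ratioP.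
  rewrite -mulNr addf_div ?tofrac_eq0 // -!rmorphN -!rmorphM -rmorphD !psiE ?mulf_neq0 //.
  by rewrite -[in RHS]mulNr addf_div ?h0 // !(rmorphD, rmorphN, rmorphM).
have psiM : monoid_morphism psi.
  split=> [|y z].
    by rewrite -(divr1 1) -(rmorph1 (@tofrac _)) psiE ?oner_neq0 // rmorph1 divr1.
  rewrite (frac_numden y) (frac_numden z).
  set n := \n_ _; set d := \d_ _; set n' := \n_ _; set d' := \d_ _.
  have d0 : d != 0 by rewrite denom_ratioP.
  have d'0 : d' != 0 by rewrite denom_ratioP.
  by rewrite mulf_div -!rmorphM !psiE ?mulf_neq0 // mulf_div !rmorphM.
pose psi' : {rmorphism {fraction R} -> E} := HB.pack psi
  (GRing.isZmodMorphism.Build _ _ _ psiB) (GRing.isMonoidMorphism.Build _ _ _ psiM).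
exists psi' => r; have := psiE r 1 (oner_neq0 _).
by rewrite !rmorph1 !divr1.
Qed.

(** * Elements to which a given homomorphism extends *)

Section GoodElements.
Variables (E0 Om L : fieldType) (i0 : {rmorphism E0 -> Om}) (psi0 : {rmorphism E0 -> L}).

(** Asking this over every field [E] that already carries an extension of [psi0], and not over [E0]
    alone, allows elements to be added one after another; so the condition is stable under the field
    operations. *)
Definition extendable (x : Om) : Prop :=
  forall (E : fieldType) (e : {rmorphism E0 -> E}) (i : {rmorphism E -> Om})
    (psi : {rmorphism E -> L}), i \o e =1 i0 -> psi \o e =1 psi0 ->
  exists (E' : fieldType) (e' : {rmorphism E -> E'}) (i' : {rmorphism E' -> Om})
    (psi' : {rmorphism E' -> L}),
    [/\ i' \o e' =1 i, psi' \o e' =1 psi & exists x', i' x' = x].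

Lemma extendable_base a : extendable (i0 a).
Proof.
move=> E e i psi ie psie; exists E, idfun, i, psi; split=> //.
by exists (e a); apply: ie.
Qed.

Lemma extendable_root (G : {poly E0}) x :
  G != 0 -> root (map_poly i0 G) x -> splits (map_poly psi0 G) -> extendable x.
Proof.
move=> G0 Gx Gs E e i psi ie psie.
have mapE (S : fieldType) (h : {rmorphism E -> S}) (h0 : {rmorphism E0 -> S}) :
    h \o e =1 h0 -> map_poly h (map_poly e G) = map_poly h0 G.
  by move=> he; rewrite -map_poly_comp; apply: eq_map_poly.
apply: (@hom_extend _ _ _ i psi x (map_poly e G)); rewrite ?map_poly_eq0 //.
- by rewrite (mapE _ _ _ ie).
- by rewrite (mapE _ _ _ psie).
Qed.

(** [op] is given on all fields at once, so that it can be computed in the common extension [E2] and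
    then mapped to [Om]. It serves for subtraction and division. *)
Lemma extendable_op (op : forall F : fieldType, F -> F -> F) :
    (forall (F F' : fieldType) (h : {rmorphism F -> F'}), {morph h : x y / op F x y >-> op F' x y}) ->
  forall x y, extendable x -> extendable y -> extendable (op Om x y).
Proof.
move=> opM x y gx gy E e i psi ie psie.
have [E1 [e1 [i1 [psi1 [ie1 psie1 [x1 x1E]]]]]] := gx E e i psi ie psie.
have [||E2 [e2 [i2 [psi2 [ie2 psie2 [y2 y2E]]]]]] := gy E1 (e1 \o e : {rmorphism E0 -> E1}) i1 psi1.
- by move=> a; rewrite -ie /= -ie1.
- by move=> a; rewrite -psie /= -psie1.
exists E2, (e2 \o e1 : {rmorphism E -> E2}), i2, psi2; split.
- by move=> a; rewrite -ie1 -[RHS]ie2.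
- by move=> a; rewrite -psie1 -[RHS]psie2.
by exists (op E2 (e2 x1) y2); rewrite opM y2E -x1E -[i1 _]ie2.
Qed.

Lemma extendable_adjoin (K : fieldType) (h : {rmorphism K -> Om}) (A : set Om) :
    (forall a, extendable (h a)) -> (forall y, A y -> extendable y) ->
  forall x, x \in in_adjoin h A -> extendable x.
Proof.
move=> gh gA x.
pose S : {pred Om} := fun x => `[< extendable x >].
have Sdiv : divring_closed S.
  split=> [|a b /asboolP ga /asboolP gb|a b /asboolP ga /asboolP gb]; apply/asboolP.
  - by rewrite -(rmorph1 i0); apply: extendable_base.
  - by apply: (@extendable_op (fun F a b => a - b)) => // F F' g u v; apply: rmorphB.
  - by apply: (@extendable_op (fun F a b => a / b)) => // F F' g u v; apply: fmorph_div.
pose S' : divringClosed Om := HB.pack S (GRing.isDivringClosed.Build Om S Sdiv).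
by move/asboolP/(_ S') => H; apply/asboolP/H => [a|y /gA]; move=> *; apply/asboolP.
Qed.
End GoodElements.

(** * Splitting of polynomial equations over Laurent series *)

Section LaurentSplitting.
Variable k : fieldType.
Notation R := (powser k).
Notation L := {fraction powser k}.
Notation cst := (laurent_const k).
Notation s := (tofrac (@ps_X k)).

Lemma s_neq0 e : s ^+ e != 0 :> L.
Proof. by rewrite expf_neq0 // tofrac_eq0 ps_X_neq0. Qed.

Lemma res_XM n (f : R) : (0 < n)%N -> ps_res (ps_X ^+ n * f) = 0.
Proof. by case: n => // n _; rewrite rmorphM rmorphXn /= exprS !mul0r. Qed.

(* [s ^ (e D) g (x / s ^ e)], cleared of denominators. *)
Definition clear_den (g : {poly k}) (e : nat) : {poly R} :=
  \poly_(i < size g) (ps_const g`_i * ps_X ^+ (e * ((size g).-1 - i))).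

Lemma clear_denE g e (x : R) : (map_poly cst g).[tofrac x / s ^+ e] * s ^+ (e * (size g).-1)
  = tofrac (clear_den g e).[x].
Proof.
rewrite [in RHS]horner_poly raddf_sum /= horner_coef size_map_poly mulr_suml.
apply: eq_bigr => i _; rewrite !rmorphM !rmorphXn /= coef_map /= -mulrA -[in RHS]mulrA.
congr (_ * _); rewrite exprMn -mulrA mulrC; congr (_ * _).
have ile : (i <= (size g).-1)%N by rewrite -ltnS (leq_trans (ltn_ord i)) // leqSpred.
apply: (mulfI (s_neq0 (e * i))).
rewrite exprVn -exprM mulrA mulfV ?s_neq0 // mul1r -exprD -mulnDr subnKC //.
Qed.

(** Every term but the leading one carries a positive power of the variable. *)
Lemma clear_den_res g e : (0 < e)%N ->
  map_poly ps_res (clear_den g e) = lead_coef g *: 'X^((size g).-1).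
Proof.
move=> e0; apply/polyP => i; rewrite coef_map coefZ coefXn coef_poly /= lead_coefE.
have [ig|gi] := ltnP i (size g); last first.
  rewrite rmorph0; case: eqP => [ie|_]; last by rewrite mulr0.
  rewrite -ie nth_default ?mul0r //.
have ile : (i <= (size g).-1)%N by rewrite -ltnS (leq_trans ig) // leqSpred.
case: eqP => [->|/eqP ie]; first by rewrite subnn muln0 expr0 !mulr1.
by rewrite mulrC res_XM ?mulr0 // muln_gt0 e0 subn_gt0 ltn_neqAle ie.
Qed.

Lemma pole_not_algebraic (u : R) e : (0 < e)%N -> ps_res u != 0 ->
  ~ algebraicOver cst (tofrac u / s ^+ e).
Proof.
move=> e0 u0 /laurent_algebraic[c /eqP]; rewrite /laurent_const /=.
rewrite -(inj_eq (mulIf (s_neq0 e))) divfK ?s_neq0 // -rmorphXn -rmorphM /=; rewrite tofrac_eq => /eqP uE.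
by move: u0; rewrite uE mulrC res_XM ?eqxx.
Qed.

(** With [x / s ^+ e] for the unknown, the cleared polynomial [Q] reduces to a multiple of ['X^D]
    minus the [D]-th power of the residue of [u]. Its roots are this residue times the powers of
    [z]; they are simple, and their Hensel lifts are distinct because their residues are. *)
Lemma laurent_splits (g : {poly k}) (z : k) (u : R) e (w := tofrac u / s ^+ e) :
    (0 < e)%N -> ps_res u != 0 -> (1 < size g)%N -> ((size g).-1)%:R != 0 :> k ->
    (size g).-1.-primitive_root z ->
  splits (map_poly cst g - ((map_poly cst g).[w])%:P).
Proof.
move=> e0 u0 g1; set D := (size g).-1 => DN zD.
have D0 : (0 < D)%N by rewrite -ltnS prednK // ltnW.
have g0 : lead_coef g != 0 by rewrite lead_coef_eq0 -size_poly_gt0 ltnW.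
have z0 : z != 0.
  apply/eqP => z0; move/esym/eqP: (prim_expr_order zD).
  by rewrite z0 expr0n gtn_eqF // oner_eq0.
pose Q := clear_den g e - (clear_den g e).[u]%:P.
have QE : map_poly ps_res Q = lead_coef g *: 'X^D - (lead_coef g * ps_res u ^+ D)%:P.
  by rewrite rmorphB /= map_polyC /= -horner_map clear_den_res // !hornerE ?hornerXn.
have hens (j : nat) : exists x, ps_res x = z ^+ j * ps_res u /\ Q.[x] = 0.
  have [||x] := @hensel k Q (z ^+ j * ps_res u); last by exists x.
    rewrite QE !hornerE ?hornerXn exprMn -exprM mulnC exprM.
    by rewrite (prim_expr_order zD) expr1n mul1r subrr.
  rewrite QE derivB derivC subr0 derivZ derivXn !hornerE ?hornerMn ?hornerXn.
  by rewrite -mulr_natl !mulf_neq0 // expf_neq0 // mulf_neq0 // expf_neq0.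
have [y yP] := choice hens.
apply: (@splits_of_roots _ _ [seq tofrac (y j) / s ^+ e | j <- index_iota 0 D]).
- rewrite map_inj_in_uniq ?iota_uniq // => a b; rewrite !mem_index_iota /= => aD bD.
  move/(mulIf _); rewrite invr_eq0 s_neq0 => /(_ isT)/eqP; rewrite tofrac_eq => /eqP.
  move/(congr1 ps_res); rewrite !(proj1 (yP _)) => /(mulIf u0)/eqP.
  by rewrite (eq_prim_root_expr zD) !modn_small // => /eqP.
- apply/allP => _ /mapP[j _ ->]; have [_ /eqP] := yP j.
  rewrite !hornerE subr_eq0 => /eqP Qy.
  rewrite /root !hornerE subr_eq0; apply/eqP/(mulIf (s_neq0 (e * D))).
  by rewrite !clear_denE Qy.
- rewrite size_map size_iota subn0 size_addl ?size_map_poly; first by rewrite prednK // ltnW.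
  by rewrite size_opp (leq_ltn_trans (size_polyC_leq1 _)).
Qed.
End LaurentSplitting.

(** * Iterates of a polynomial, and generated subfields *)

Definition iterp (K : fieldType) (p : {poly K}) (m : nat) : {poly K} :=
  iter m (fun q => p \Po q) 'X.

Lemma horner_iterp (K E : fieldType) (i : {rmorphism K -> E}) (p : {poly K}) m x :
  (map_poly i (iterp p m)).[x] = iter m (horner (map_poly i p)) x.
Proof.
elim: m => [|m IH]; first by rewrite map_polyX hornerX.
by rewrite [iterp _ _]iterS /= map_comp_poly horner_comp IH.
Qed.

Lemma size_iterp (K : fieldType) (p : {poly K}) m :
  (size (iterp p m)).-1 = ((size p).-1 ^ m)%N.
Proof.
elim: m => [|m IH]; first by rewrite size_polyX.
by rewrite [iterp _ _]iterS size_comp_poly IH expnS.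
Qed.

(** The series [u] is the reversed polynomial of [h] in the variable [s], with constant coefficient
    the leading coefficient of [h]. *)
Lemma pole_horner (k : fieldType) (h : {poly k}) :
  exists2 u : powser k, ps_res u = lead_coef h &
    (map_poly (laurent_const k) h).[(tofrac ps_X)^-1] = tofrac u / tofrac ps_X ^+ (size h).-1.
Proof.
exists (clear_den h 1).[1].
  by rewrite -horner_map clear_den_res // !hornerE ?hornerXn rmorph1 expr1n mulr1.
apply: (mulIf (s_neq0 k (size h).-1)); rewrite divfK ?s_neq0 //.
by have := clear_denE h 1 1; rewrite rmorph1 expr1 mul1r mul1n.
Qed.

Lemma algebraicOver_hom (A B C D : fieldType) (h : {rmorphism A -> B})
    (g : {rmorphism C -> D}) (a : {rmorphism A -> C}) (b : {rmorphism B -> D}) x :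
  (forall y, g (a y) = b (h y)) -> algebraicOver h x -> algebraicOver g (b x).
Proof.
move=> gab [P P0 Px]; exists (map_poly a P); first by rewrite map_poly_eq0.
by rewrite -map_poly_comp (@eq_map_poly _ _ _ (b \o h)) // map_poly_comp fmorph_root.
Qed.

Lemma in_adjoin_sub (K L : fieldType) (i : {rmorphism K -> L}) (A B : set L) x :
  (A `<=` B)%classic -> x \in in_adjoin i A -> x \in in_adjoin i B.
Proof.
move=> AB /asboolP H; apply/asboolP => S iS BS; apply: H => // y /AB; exact: BS.
Qed.

(** The union of an increasing chain of subfields is a subfield. *)
Lemma in_adjoin_filtered (K L : fieldType) (i : {rmorphism K -> L}) (A : nat -> set L) x :
  (forall m n, (m <= n)%N -> (A m `<=` A n)%classic) ->
  x \in in_adjoin i [set y | exists n, A n y]%classic ->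
  exists n, x \in in_adjoin i (A n).
Proof.
move=> Amono.
pose S : {pred L} := fun x => `[< exists n, x \in in_adjoin i (A n) >].
have Sdiv : divring_closed S.
  split=> [|a b /asboolP[m am] /asboolP[n bn]|a b /asboolP[m am] /asboolP[n bn]];
    apply/asboolP; first by exists 0%N; apply: rpred1.
  - exists (maxn m n); apply: rpredB.
      by apply: in_adjoin_sub am; apply/Amono/leq_maxl.
    by apply: in_adjoin_sub bn; apply/Amono/leq_maxr.
  - exists (maxn m n); apply: rpred_div.
      by apply: in_adjoin_sub am; apply/Amono/leq_maxl.
    by apply: in_adjoin_sub bn; apply/Amono/leq_maxr.
pose S' : divringClosed L := HB.pack S (GRing.isDivringClosed.Build L S Sdiv).
move/asboolP/(_ S') => H; apply/asboolP/H => [a|y [n Any]]; apply/asboolP.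
  by exists 0%N; apply: base_in_adjoin.
by exists n; apply/asboolP => T _; apply.
Qed.

(** * Constants are polynomials in roots of unity *)

Section ConstantExtension.
Variables (K Om : fieldType) (iota : {rmorphism ratfun K -> Om}).
Hypothesis hOm : is_separable_closure iota.
Variable p : {poly K}.
Notation d := (size p).-1.
Hypotheses (d_gt0 : (0 < d)%N) (dK : d%:R != 0 :> K).
Notation K0 := (base_emb iota).

Lemma ratvar_transcendental : ~ algebraicOver K0 (iota (ratvar K)).
Proof.
case=> P P0; rewrite map_poly_comp fmorph_root /root.
have -> : (map_poly (ratconst K) P).[ratvar K] = tofrac P.
  by rewrite map_poly_comp horner_map /= -/(comp_poly _ _) comp_polyXr.
by rewrite tofrac_eq0 (negPf P0).
Qed.

(** An embedding of [K(t)] into the Laurent series over [K(z)] extends to a field containing [x] and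
    [z]. The image of [x] is algebraic, hence a constant in [K(z)]; its polynomial expression in
    [zeta] is then pulled back to [Om]. *)
Lemma const_in_cyclotomic x :
    x \in in_adjoin K0 [set y | exists n, iter n (horner (map_poly K0 p)) y = iota (ratvar K)]%classic ->
    algebraicOver K0 x ->
  exists n z, (d ^ n)%N.-primitive_root z /\ exists P, x = (map_poly K0 P).[z].
Proof.
set t := iota _ => xB ax.
pose B n : set Om := [set y | exists2 m, (m <= n)%N & iter m (horner (map_poly K0 p)) y = t]%classic.
have [n xn] : exists n, x \in in_adjoin K0 (B n).
  apply: in_adjoin_filtered.
    by move=> a b ab y [m ma yt]; exists m => //; apply: leq_trans ab.
  by apply: in_adjoin_sub xB => y [m yt]; exists m, m.
have dn0 m : (0 < d ^ m)%N by rewrite expn_gt0 d_gt0.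
have dnK m (E : fieldType) (h : {rmorphism K -> E}) : (d ^ m)%:R != 0 :> E.
  by rewrite natrX expf_neq0 // -(rmorph_nat h) fmorph_eq0.
have it0 m : iterp p m != 0.
  apply: contraTneq (dn0 m) => it0; by rewrite -size_iterp it0 size_poly0.
have [z zn] := exists_prim_root (proj2 hOm) (dn0 n) (dnK n _ K0).
exists n, z; split=> //.
have az : algebraicOver K0 z.
  exists ('X^(d ^ n) - 1); first by rewrite -size_poly_eq0 size_XnsubC.
  by rewrite rmorphB rmorph1 /= map_polyXn rootE !hornerE ?hornerXn (prim_expr_order zn) subrr.
pose k := adjoin K0 [set z]%classic.
pose j : {rmorphism K -> k} := adjoin_base K0 [set z]%classic.
have zk : z \in in_adjoin K0 [set z]%classic by apply/asboolP => S _; apply.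
pose v : {rmorphism k -> Om} := (val : k -> Om).
pose zeta : k := Subfield zk.
have vj : v \o j =1 K0 by [].
have zetan : (d ^ n)%N.-primitive_root zeta by rewrite -(fmorph_primitive_root v).
pose L := {fraction powser k}; pose cst := laurent_const k.
pose jL : {rmorphism K -> L} := cst \o j.
pose F m := iter m (horner (map_poly jL p)).
have pole m : exists2 u : powser k, ps_res u != 0 & F m (tofrac ps_X)^-1 = tofrac u / tofrac ps_X ^+ (d ^ m).
  have [u u0 uE] := pole_horner (map_poly j (iterp p m)).
  exists u; first by rewrite u0 lead_coef_eq0 map_poly_eq0.
  rewrite /F -horner_iterp map_poly_comp uE size_map_poly size_iterp //.
(* The image of [t]. As an [n]-th iterate it provides, for each [m <= n], a solution of
   [p^m(Y) = t], namely [F (n - m)] at [1/s]. *)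
pose y := F n (tofrac ps_X)^-1.
have y_tr : ~ algebraicOver jL y.
  move=> ay; have [u u0 uE] := pole n.
  apply: (pole_not_algebraic (dn0 n) u0); rewrite -uE.
  by apply: (@algebraicOver_hom _ _ _ _ jL cst j idfun) ay.
have [psi0 psi0E] : exists psi0 : {rmorphism ratfun K -> L},
    forall P, psi0 (tofrac P) = (map_poly jL P).[y].
  pose h : {rmorphism {poly K} -> L} := (horner_eval y \o map_poly jL).
  have [|psi0 psi0E] := @frac_hom _ _ h; last by exists psi0.
  apply: raddf_inj => P /eqP hP; apply: contrapT => /eqP P0; apply: y_tr.
  by exists P.
have psi0c a : psi0 (ratconst K a) = jL a by rewrite psi0E map_polyC hornerC.
have psi0t : psi0 (ratvar K) = y by rewrite psi0E map_polyX hornerX.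
have gB w : B n w -> extendable iota psi0 w.
  case=> m mn wt; pose G := map_poly (ratconst K) (iterp p m) - (ratvar K)%:P.
  have szp : size (map_poly j (iterp p m)) = (d ^ m).+1.
    rewrite size_map_poly -(size_iterp p m) prednK // size_poly_gt0 ?it0 //.
  apply: (@extendable_root _ _ _ _ _ G).
  - rewrite -size_poly_eq0 size_addl size_map_poly -(size_map_poly j) szp //.
    by rewrite size_opp ltnS (leq_trans (size_polyC_leq1 _)).
  - rewrite rmorphB /= map_polyC -map_poly_comp /root !hornerE subr_eq0.
    by rewrite (horner_iterp K0) wt.
  - have -> : map_poly psi0 G = map_poly cst (map_poly j (iterp p m)) -
       ((map_poly cst (map_poly j (iterp p m))).[F (n - m)%N (tofrac ps_X)^-1])%:P.
      rewrite -!map_poly_comp (horner_iterp jL) -iterD subnKC //.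
      rewrite rmorphB /= map_polyC -map_poly_comp /= psi0t; congr (_ - _).
      exact: eq_map_poly.
    have [u u0 ->] := pole (n - m)%N.
    (* The iterate has degree [d ^ m], and this power of [zeta] is primitive of exactly that
       order. *)
    apply: (@laurent_splits _ _ (zeta ^+ (d ^ (n - m))%N)); rewrite ?szp ?dn0 ?ltnS //.
    - exact: dnK j.
    - by rewrite expnB // dvdn_prim_root // dvdn_exp2l.
have gx : extendable iota psi0 x.
  apply: extendable_adjoin xn => [a|w /gB //].
  exact: extendable_base.
have gz : extendable iota psi0 z.
  pose G : {poly ratfun K} := 'X^(d ^ n) - 1.
  apply: (@extendable_root _ _ _ _ _ G).
  - by rewrite -size_poly_eq0 size_XnsubC.
  - by rewrite rmorphB rmorph1 /= map_polyXn rootE !hornerE ?hornerXn (prim_expr_order zn) subrr.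
  - rewrite rmorphB rmorph1 /= map_polyXn.
    exists 1; first exact: oner_neq0.
    exists [seq cst zeta ^+ a | a <- index_iota 0 (d ^ n)].
    rewrite big_map scale1r; symmetry; apply: factor_Xn_sub_1.
    by rewrite fmorph_primitive_root.
have [E1 [e1 [i1 [psi1 [ie1 psie1 [x1 x1E]]]]]] := gx _ idfun iota psi0 (frefl _) (frefl _).
have [||E2 [e2 [i2 [psi2 [ie2 psie2 [z2 z2E]]]]]] := gz _ e1 i1 psi1; [by [] | by [] | ].
pose e : {rmorphism K -> E2} := e2 \o e1 \o ratconst K.
have map_i2 P : map_poly i2 (map_poly e P) = map_poly K0 P.
  rewrite -map_poly_comp; apply: eq_map_poly => a.
  by rewrite /= [i2 _]ie2 [i1 _]ie1.
have map_psi2 P : map_poly psi2 (map_poly e P) = map_poly jL P.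
  rewrite -map_poly_comp; apply: eq_map_poly => a.
  by rewrite /= [psi2 _]psie2 [psi1 _]psie1 /= psi0c.
have x2E : i2 (e2 x1) = x by rewrite [i2 _]ie2.
have ax2 : algebraicOver cst (psi2 (e2 x1)).
  case: ax => P P0; rewrite -x2E => Px.
  exists (map_poly j P); first by rewrite map_poly_eq0.
  by move: Px; rewrite -map_i2 fmorph_root => Px; rewrite -map_poly_comp -map_psi2 fmorph_root.
have [c cE] := laurent_algebraic ax2.
have [P PE] := in_adjoin1P az (valP c).
have cP : c = (map_poly j P).[zeta].
  apply: (fmorph_inj v); rewrite -horner_map -map_poly_comp; exact: PE.
have z2n : (d ^ n)%N.-primitive_root (psi2 z2).
  by rewrite fmorph_primitive_root -(fmorph_primitive_root i2) z2E.
(* The extension may send [z] to another primitive root than [zeta]; the exponent [a] corrects for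
   this. *)
have [a aE] : exists a, cst zeta = psi2 z2 ^+ a.
  have [|a aE] := @prim_rootP _ _ _ z2n (cst zeta); last by exists a.
  by rewrite -rmorphXn (prim_expr_order zetan) rmorph1.
exists (P \Po 'X^a); rewrite map_comp_poly map_polyXn horner_comp hornerXn -z2E -x2E.
rewrite -rmorphXn -map_i2 horner_map; congr (i2 _); apply: (fmorph_inj psi2).
by rewrite cE cP -horner_map -map_poly_comp -horner_map map_psi2 rmorphXn aE.
Qed.
End ConstantExtension.

Section PolynomialMap.
Variables (K Om : fieldType) (iota : {rmorphism ratfun K -> Om}) (p : {poly K}).
Notation K0 := (base_emb iota).

Lemma tame_polynomial_degree :
  tamely_ramified iota (tofrac p) -> (0 < (size p).-1)%N /\ ((size p).-1)%:R != 0 :> K.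
Proof.
case=> phi [phic phiX tame].
pose q := map_poly (algclosure_base K0) p.
have emb_horner P : (map_poly (geom_const_emb iota) P).[ratvar (geom_consts iota)]
    = tofrac (map_poly (algclosure_base K0) P).
  by rewrite map_poly_comp [map_poly (ratconst _) _]map_poly_comp horner_map /= -/(comp_poly _ _) comp_polyXr.
have := @tame_degree _ phi q phic _ tame; rewrite size_map_poly -(rmorph_nat (algclosure_base K0)) fmorph_eq0; apply.
rewrite phiX ratfun_eval_poly ?emb_horner //.
by rewrite tofrac_eq0 map_poly_eq0 denom_ratioP.
Qed.

(** A point where the denominator vanishes is algebraic over [K], and so are all its iterates,
    division by zero giving [0]; none of them can be the transcendental [t]. *)
Lemma backward_orbit_polynomial x :
  backward_orbit iota (tofrac p) x ->
  exists n, iter n (horner (map_poly K0 p)) x = iota (ratvar K).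
Proof.
case=> n xt; exists n; set F := ratfun_eval _ _ in xt.
have F_alg y : algebraicOver K0 y -> algebraicOver K0 (F y).
  by move=> ay; apply: algebraic_div; apply: algebraic_horner.
have iter_alg m y : algebraicOver K0 y -> algebraicOver K0 (iter m F y).
  by move=> ay; elim: m => // m IH; apply: F_alg.
elim: n x xt => [|n IH] x //; rewrite !iterSr => xt.
suff Fx : F x = (map_poly K0 p).[x] by rewrite -Fx; apply: IH.
apply: ratfun_eval_poly; apply/negP => dx.
apply: (@ratvar_transcendental _ _ iota); rewrite -xt -iterSr; apply: iter_alg.
by exists \d_(repr (tofrac p)); rewrite ?denom_ratioP.
Qed.

Definition const_field_emb : {rmorphism const_field_ext iota (tofrac p) -> Om} :=
  (val : adjoin K0 (backward_orbit iota (tofrac p)) -> Om)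
  \o (val : const_field_ext iota (tofrac p) -> adjoin K0 (backward_orbit iota (tofrac p))).

Lemma const_field_cyclotomic (x : const_field_ext iota (tofrac p)) :
    is_separable_closure iota -> tamely_ramified iota (tofrac p) ->
  exists n z, ((size p).-1 ^ n)%N.-primitive_root z /\
    exists P, const_field_emb x
      = (map_poly (const_field_emb \o const_field_ext_base iota (tofrac p)) P).[z].
Proof.
move=> hOm /tame_polynomial_degree[d0 dK].
have := @const_in_cyclotomic _ _ _ hOm p d0 dK (const_field_emb x).
case.
- apply: in_adjoin_sub (valP (val x)) => y; exact: backward_orbit_polynomial.
- have /asboolP ax := valP x.
  exact: (@algebraicOver_hom _ _ _ _ (adjoin_base K0 (backward_orbit iota (tofrac p))) K0 idfun
     (val : adjoin K0 (backward_orbit iota (tofrac p)) -> Om) _ _ ax).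
- move=> n [z [zn [P PE]]]; exists n, z; split=> //; exists P.
  by rewrite PE; congr (_.[_]); apply: eq_map_poly.
Qed.
End PolynomialMap.

(** * Counting subgroups *)

Section TorsionCount.
Local Open Scope nat_scope.
Variables (d n k : nat).
Hypotheses (d_gt0 : 0 < d) (k_gt0 : 0 < k).
Let N := d ^ n.

(** The sum is congruent to [k * y ^ k.-1] modulo [d ^ k]. Let [q ^ j] be the exact power of a prime
    [q] in the gcd; [q] divides [d] and not [y]. If [j <= k], the congruence gives that [q ^ j]
    divides [k]; if [j > k], it gives that [q ^ k] divides [k], which is too small. *)
Lemma gcd_power_sum (x y m : nat) : x = y + d ^ k * m -> coprime y N ->
  gcdn (\sum_(i < k) x ^ (k.-1 - i) * y ^ i) N %| k.
Proof.
move=> xE yN; set S := \sum_(_ < _) _; set e := gcdn S N.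
have e0 : 0 < e by rewrite gcdn_gt0 expn_gt0 d_gt0 orbT.
have xy i : x ^ i = y ^ i %[mod d ^ k].
  by rewrite xE -modnXm addnC mulnC modnMDl modnXm.
have SE : S = k * y ^ k.-1 %[mod d ^ k].
  have -> : k * y ^ k.-1 = \sum_(i < k) y ^ k.-1 by rewrite sum_nat_const card_ord.
  rewrite /S -modn_summ -[RHS]modn_summ; congr (_ %% _); apply: eq_bigr => i _.
  rewrite -modnMml xy modnMml -expnD subnK //.
  by rewrite -ltnS prednK.
apply/dvdn_partP => // q; rewrite mem_primes => /and3P[q_pr _ qe].
rewrite p_part; set j := logn q e.
have qjS : q ^ j %| S by rewrite (dvdn_trans (pfactor_dvdnn q e)) ?dvdn_gcdl.
have qd : q %| d.
  by move: (dvdn_trans qe (dvdn_gcdr _ _)); rewrite Euclid_dvdX // => /andP[].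
have qy : coprime q y.
  rewrite coprime_sym; apply: coprime_dvdr yN.
  exact: dvdn_trans qe (dvdn_gcdr _ _).
have q_dvd i : i <= k -> q ^ i %| S -> q ^ i %| k.
  move=> ik; have qdk : q ^ i %| d ^ k by rewrite (dvdn_trans (dvdn_exp2l q ik)) // dvdn_exp2r.
  move: SE => /(congr1 (modn^~ (q ^ i))); rewrite !modn_dvdm // /dvdn => ->.
  by rewrite -/(dvdn _ _) Gauss_dvdl // coprimeXl // coprimeXr.
have [jk|kj] := leqP j k; first exact: q_dvd.
have /dvdn_leq := q_dvd k (leqnn k) (dvdn_trans (dvdn_exp2l q (ltnW kj)) qjS).
by move/(_ k_gt0); rewrite leqNgt ltn_expl ?prime_gt1.
Qed.

(** [N] divides [x ^ k - y ^ k], which is [x - y] times the sum of [gcd_power_sum], and that sum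
    shares with [N] only a divisor of [gcdn k N]. *)
Lemma torsion_congr (x y : nat) : y <= x -> coprime y N ->
  x = y %[mod d ^ k] -> x ^ k = y ^ k %[mod N] -> N %/ gcdn k N %| x - y.
Proof.
move=> yx yN /eqP; rewrite eqn_mod_dvd // => /dvdnP[m mE].
move=> /eqP; rewrite eqn_mod_dvd ?leq_exp2r // subn_exp.
set S := \sum_(_ < _) _ => NS.
have N0 : 0 < N by rewrite expn_gt0 d_gt0.
have : gcdn S N %| gcdn k N.
  rewrite dvdn_gcd dvdn_gcdr andbT; apply: (@gcd_power_sum x y m) => //.
  by rewrite mulnC -mE subnKC.
set g := gcdn k N => Sg.
have g0 : 0 < g by rewrite gcdn_gt0 k_gt0.
have : N %| (x - y) * g.
  have : N %| (x - y) * gcdn S N by rewrite muln_gcdr dvdn_gcd NS dvdn_mull.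
  by move/dvdn_trans; apply; rewrite dvdn_mul.
by rewrite -{1}(divnK (dvdn_gcdr k N)) -/g dvdn_pmul2r.
Qed.

(** Solutions with the same residue modulo [d ^ k] agree modulo [M = N / gcd(k, N)], so the quotient
    by [M], which is less than [k], separates them. *)
Lemma torsion_units : 1 < N -> #|[set x : {unit 'Z_N} | (x ^+ k == 1)%g]| <= d ^ k * k.
Proof.
move=> N1.
pose v (x : {unit 'Z_N}) : nat := val x.
have v_lt x : v x < N by have := ltn_ord (val x); rewrite [X in _ < X](Zp_cast N1).
have vE (x : 'Z_N) : x = (x : nat)%:R%R by rewrite Zp_nat; apply: val_inj; rewrite /= modn_small.
have vk x : v x ^ k = v (x ^+ k)%g %[mod N].
  rewrite /v FinRing.val_unitX [in RHS](vE (val x)) -natrX val_Zp_nat // modn_mod //.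
have v_cop x : coprime (v x) N.
  by rewrite coprime_sym -unitZpE // -vE; apply: valP.
set T := [set x | _]; set M := N %/ gcdn k N.
have N0 : 0 < N by apply: ltnW.
have g0 : 0 < gcdn k N by rewrite gcdn_gt0 k_gt0.
have NE : N = M * gcdn k N by rewrite divnK ?dvdn_gcdr.
have M0 : 0 < M by move: N0; rewrite {1}NE muln_gt0 => /andP[].
have dk0 : 0 < d ^ k by rewrite expn_gt0 d_gt0.
have lt_k x : v x %/ M < k.
  rewrite ltn_divLR //; apply: leq_trans (v_lt x) _.
  by rewrite {1}NE mulnC leq_mul2r dvdn_leq ?dvdn_gcdl ?orbT.
pose h x : 'I_(d ^ k) * 'I_k := (Ordinal (ltn_pmod (v x) dk0), Ordinal (lt_k x)).
have hI : {in T &, injective h}.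
  move=> x y; rewrite !inE => /eqP xk /eqP yk [xy_mod xy_div].
  wlog xy : x y xk yk xy_mod xy_div / v y <= v x => [IH|].
    by have [yx|/ltnW xy] := leqP (v y) (v x); [apply: IH | symmetry; apply: IH].
  have := torsion_congr xy (v_cop y) xy_mod.
  rewrite !vk xk yk => /(_ erefl); rewrite -/M -eqn_mod_dvd // => /eqP xyM.
  apply/val_inj/val_inj; change (v x = v y).
  by rewrite (divn_eq (v x) M) (divn_eq (v y) M) xy_div xyM.
have <- : #|{: 'I_(d ^ k) * 'I_k}| = d ^ k * k by rewrite card_prod !card_ord.
by rewrite -(card_in_imset hI) max_card.
Qed.
End TorsionCount.

Lemma map_Xn_sub_1 (A B : fieldType) (h : {rmorphism A -> B}) N :
  (map_poly h ('X^N - 1) = 'X^N - 1)%R.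
Proof. by rewrite rmorphB rmorph1 /= map_polyXn. Qed.

(** Two of the powers [s ^+ 0], ..., [s ^+ n] share a left coset, so [H] contains some [s ^+ j] with
    [0 < j <= n]. As [H] may fail to be normal, [j] need not divide [n], but it divides the
    factorial. *)
Lemma index_exp (G : groupType) (H : {pred G}) n s :
  group_closed H -> has_index H n -> (s ^+ n`!)%g \in H.
Proof.
move=> gH [g gP].
pose c (a : 'I_n.+1) : 'I_n := projT1 (cid (gP (s ^+ a)%g)).
have cP (a : 'I_n.+1) : ((g (c a))^-1 * s ^+ a)%g \in H.
  by rewrite /c; case: cid => b /= [].
have [a [b [ab cab]]] : exists a b : 'I_n.+1, (a < b)%N /\ c a = c b.
  have /injectivePn[a [b ab cab]] : ~~ injectiveb c.
    by apply/injectiveP => /leq_card; rewrite !card_ord ltnn.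
  move: ab; rewrite neq_ltn => /orP[ab|ab]; [by exists a, b | by exists b, a].
have sH : (s ^+ (b - a)%N)%g \in H.
  have := group_closedM gH (group_closedV gH (cP a)) (cP b).
  have -> : (s ^+ b = s ^+ a * s ^+ (b - a)%N)%g by rewrite -expgnDr subnKC // ltnW.
  by rewrite cab invgM invgK !mulgA mulgK mulVg mul1g.
have /dvdnP[q ->] : (b - a %| n`!)%N.
  rewrite dvdn_fact // subn_gt0 ab /= (leq_trans (leq_subr _ _)) // -ltnS.
  exact: ltn_ord.
have HX t m : t \in H -> (t ^+ m)%g \in H.
  move=> tH; elim: m => [|m IH]; first by case: gH.
  by rewrite expgS; apply: (group_closedM gH).
by rewrite mulnC expgnA HX.
Qed.

(** * Galois action on a field of cyclotomic elements *)

Section CyclotomicSubfield.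
Variables (K F Om : fieldType) (i : {rmorphism K -> F}) (v : {rmorphism F -> Om}).
Variable d : nat.
Hypothesis d_gt0 : (0 < d)%N.
Local Notation K0 := (v \o i).
Hypothesis cyclo : forall x : F, exists n z, (d ^ n)%N.-primitive_root z /\
  exists P, v x = (map_poly K0 P).[z].

(** The highest of finitely many levels serves for all: for [m <= n], a root of unity of order
    [d ^ m] is a power of any primitive one of order [d ^ n]. *)
Lemma common_level (S : seq F) : exists n z, (d ^ n)%N.-primitive_root z /\
  forall x, x \in S -> exists P, v x = (map_poly K0 P).[z].
Proof.
have lift (x : F) m n (z w : Om) : (m <= n)%N -> (d ^ m)%N.-primitive_root w ->
    (d ^ n)%N.-primitive_root z -> (exists P, v x = (map_poly K0 P).[w]) ->
    exists P, v x = (map_poly K0 P).[z].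
  move=> mn wm zn [P xP].
  have [|a aE] := @prim_rootP _ _ _ zn w.
    by rewrite -(subnK mn) expnD mulnC exprM (prim_expr_order wm) expr1n.
  exists (P \Po 'X^a).
  by rewrite map_comp_poly map_polyXn horner_comp hornerXn -aE.
elim: S => [|y S [n [z [zn SP]]]].
  have [m m1 dvd_m1] := @prim_order_exists _ 1 (1 : Om) isT (expr1n _ _).
  by exists 0%N, 1; split=> //; move: m1; rewrite (eqP (_ : m == 1%N)) // -dvdn1.
have [m [w [wm yP]]] := cyclo y.
have [mn|/ltnW nm] := leqP m n.
  by exists n, z; split=> // x; rewrite inE => /predU1P[->|/SP //]; apply: (lift _ m n z w).
exists m, w; split=> // x; rewrite inE => /predU1P[-> //|/SP]; exact: (lift x n m w z).
Qed.

(** As [z] may lie outside [F], the substitution of [z ^+ u] for [z] is only tested on elements of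
    [F] that are polynomials in [z]. *)
Definition acts (z : Om) (s : Gal i) (u : nat) : Prop :=
  forall x P, v x = (map_poly K0 P).[z] -> v (gal_fun s x) = (map_poly K0 P).[z ^+ u].

Lemma acts1 z : acts z 1%g 1.
Proof. by []. Qed.

Lemma actsM z s t u w : acts z s u -> acts z t w -> acts z (s * t)%g (u * w).
Proof.
move=> su tw x P xP; have := su _ (P \Po 'X^w).
rewrite map_comp_poly map_polyXn !horner_comp !hornerXn -exprM; apply.
exact: tw.
Qed.

Lemma actsX z s u k : acts z s u -> acts z (s ^+ k)%g (u ^ k).
Proof.
move=> su; elim: k => [|k IH]; first exact: acts1.
by rewrite expgS expnS; apply: actsM.
Qed.

(** Extend [v \o s] to [F(z)]: the image of [z] is again a primitive [N]-th root of unity, hence a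
    power of [z] with exponent prime to [N]. *)
Lemma acts_exists N z s : N.-primitive_root z -> exists u, coprime u N /\ acts z s u.
Proof.
move=> zN; have [sB sM _ si] := galP s.
have N0 := prim_order_gt0 zN.
pose s' : {rmorphism F -> F} := HB.pack (gal_fun s)
  (GRing.isZmodMorphism.Build _ _ _ sB) (GRing.isMonoidMorphism.Build _ _ _ sM).
pose G : {poly F} := 'X^N - 1.
have G0 : G != 0 by rewrite -size_poly_eq0 size_XnsubC.
have Gz : root (map_poly v G) z.
  by rewrite rmorphB rmorph1 /= map_polyXn rootE !hornerE ?hornerXn (prim_expr_order zN) subrr.
have Gs : splits (map_poly (v \o s') G).
  have -> : map_poly (v \o s') G = 'X^N - 1.
    exact: map_Xn_sub_1.
  exists 1; first exact: oner_neq0.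
  exists [seq z ^+ a | a <- index_iota 0 N].
  by rewrite big_map scale1r; symmetry; apply: factor_Xn_sub_1.
have [E [e [v' [psi [v'e psie [y yz]]]]]] := hom_extend G0 Gz Gs.
have yN : N.-primitive_root (psi y).
  by rewrite fmorph_primitive_root -(fmorph_primitive_root v') yz.
have [|u uE] := @prim_rootP _ _ _ zN (psi y); first exact: prim_expr_order.
exists u; split; first by move: yN; rewrite uE prim_root_exp_coprime.
move=> x P xP.
have mapE (h : {rmorphism E -> Om}) : h \o e \o i =1 K0 ->
    h (map_poly (e \o i) P).[y] = (map_poly K0 P).[h y].
  move=> hE; rewrite -horner_map -map_poly_comp; congr _.[_]; exact: eq_map_poly.
have ex : e x = (map_poly (e \o i) P).[y].
  apply: (fmorph_inj v'); rewrite mapE ?yz -?xP; first exact: v'e.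
  by move=> a; apply: v'e.
rewrite -uE -mapE; last by move=> a; rewrite /= [psi _]psie /= si.
by rewrite -ex [psi _]psie.
Qed.

(** Equality up to a [k]-th power and an automorphism fixing [S] pointwise. A subgroup containing
    all of these contains [s] exactly when it contains [t]. *)
Definition pow_equiv (k : nat) (S : seq F) (s t : Gal i) : Prop :=
  exists tau : Gal i, {in S, gal_fun t =1 gal_fun (s * tau ^+ k)%g}.

(** On [S] an automorphism acts through a unit modulo [N]. Inequivalent automorphisms give distinct
    cosets of the [k]-th powers in the group [U] of units that occur, and their number has a bound
    independent of [S]. *)
Lemma inequiv_bound k S (r : nat -> Gal i) m : (0 < k)%N ->
    (forall a b, (a < b < m)%N -> ~ pow_equiv k S (r a) (r b)) ->
  (m <= d ^ k * k)%N.
Proof.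
move=> k0 rP; have [n [z [zN SP]]] := common_level S.
set N := (d ^ n)%N in zN.
have [N1|N1] := leqP N 1.
  (* This case is separate because ['Z_N] is the ring of integers modulo [N] only for [N > 1]. Here
     [S] lies in the image of [K], where all automorphisms agree. *)
  have {}N1 : N = 1%N by apply/eqP; rewrite eqn_leq N1 (prim_order_gt0 zN).
  have z1 : z = 1 by have := prim_expr_order zN; rewrite N1 expr1.
  suff m1 : (m <= 1)%N by rewrite (leq_trans m1) // muln_gt0 expn_gt0 d_gt0 k0.
  rewrite leqNgt; apply/negP => m1; apply: (rP 0%N 1%N) => //.
  exists 1%g => x xS; rewrite expg1n mulg1.
  have [P PE] := SP x xS.
  have -> : x = i P.[1].
    by apply: (fmorph_inj v); rewrite PE z1 -(rmorph1 K0) horner_map.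
  by have [_ _ _ ->] := galP (r 1%N); have [_ _ _ ->] := galP (r 0%N).
pose uv (u : {unit 'Z_N}) : nat := (val u : 'Z_N).
have actsE s (u w : nat) : u = w %[mod N] -> acts z s u -> acts z s w.
  move=> uw su x P /su ->; congr (_.[_]).
  by rewrite -(prim_expr_mod zN) uw (prim_expr_mod zN).
have ufE s : exists u, acts z s (uv u).
  have [u [uN su]] := acts_exists s zN.
  have uU : (u%:R : 'Z_N) \is a GRing.unit by rewrite unitZpE // coprime_sym.
  exists (FinRing.unit 'Z_N uU); apply: actsE su.
  by rewrite /uv /= val_Zp_nat // modn_mod.
have [uf ufP] := choice ufE.
pose U := [set u : {unit 'Z_N} | `[< exists s, acts z s (uv u) >]].
have uvM (u w : {unit 'Z_N}) : uv (u * w)%g = (uv u * uv w)%N %[mod N].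
  have vE (x : 'Z_N) : x = (x : nat)%:R by rewrite Zp_nat; apply: val_inj; rewrite /= modn_small.
  rewrite /uv FinRing.val_unitM {1}(vE (val u)) {1}(vE (val w)) -natrM.
  by rewrite val_Zp_nat // modn_mod.
have uvX (u : {unit 'Z_N}) m' : uv (u ^+ m')%g = (uv u ^ m')%N %[mod N].
  elim: m' => [|m' IH]; first by [].
  by rewrite expgS uvM expnS -modnMmr IH modnMmr.
have inU (u : {unit 'Z_N}) : reflect (exists s, acts z s (uv u)) (u \in U).
  by rewrite inE; apply: asboolP.
have gU : group_set U.
  apply/group_setP; split; first by apply/inU; exists 1%g; apply: acts1.
  move=> u w /inU[s su] /inU[t tw]; apply/inU.
  by exists (s * t)%g; apply: actsE (actsM su tw); rewrite uvM.
pose GU := fingroup.Group gU.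
pose pw (u : {unit 'Z_N}) := (u ^+ k)%g.
have pwM : {in GU &, {morph pw : x y / (x * y)%g}}.
  move=> x y _ _; apply: expgMn; exact: unit_Zp_mulgC.
pose f : {morphism GU >-> {unit 'Z_N}} := Morphism pwM.
(* In the finite abelian group [U], the index of the image of the [k]-th power map equals the order
   of its kernel. *)
have idxE : #|GU : f @* GU|%g = #|'ker f|%g.
  have sfG : (f @* GU \subset GU)%g.
    apply/fintype.subsetP => _ /morphimP[x _ xG ->]; exact: groupX.
  apply/eqP; rewrite -(eqn_pmul2l (cardG_gt0 (f @* GU)%G)) (Lagrange sfG).
  by rewrite card_morphim finset.setIid mulnC (Lagrange (normal_sub (ker_normal f))).
have kerle : (#|'ker f|%g <= d ^ k * k)%N.
  apply: leq_trans (torsion_units d_gt0 k0 N1); apply/subset_leq_card/fintype.subsetP => x.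
  by rewrite !inE => /andP[].
rewrite (leq_trans _ kerle) // -idxE.
pose h (a : 'I_m) := ((f @* GU)%G :* uf (r a))%g.
have hI : injective h.
  move=> a b hab; apply: contrapT => /eqP; rewrite neq_ltn => ab.
  wlog lt_ab : a b hab ab / (a < b)%N => [IH|].
    by case/orP: (ab) => ab'; [apply: (IH a b) | apply: (IH b a) => //; rewrite orbC].
  (* If the cosets coincide, the two units differ by the [k]-th power of a unit realised by some
     [tau], so [r b] agrees with [r a * tau ^+ k] on [S]. *)
  have : uf (r b) \in h a by rewrite hab rcoset_refl.
  case/rcosetP => _ /morphimP[w _ /inU[tau tauw] ->] rbE.
  apply: (rP a b); first by rewrite lt_ab ltn_ord.
  exists tau => x /SP[P xP]; apply: (fmorph_inj v).
  rewrite (ufP _ _ _ xP) (actsM (ufP _) (actsX k tauw) xP).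
  by congr (_.[_]); rewrite -(prim_expr_mod zN) rbE uvM -modnMml uvX modnMml mulnC prim_expr_mod.
rewrite -(card_ord m) -(card_imset _ hI); apply/subset_leq_card/fintype.subsetP => _ /imsetP[a _ ->].
by apply/rcosetsP; exists (uf (r a)) => //; apply/inU; exists (r a).
Qed.
End CyclotomicSubfield.

Lemma finite_set_code (T : Type) (C : finType) (A : set T) (code : T -> C) :
  (forall x y, A x -> A y -> code x = code y -> x = y) -> finite_set A.
Proof.
move=> codeI; have [[x0 Ax0]|nA] := pselect (exists x, A x); last first.
  suff -> : A = set0 by exact: finite_set0.
  by apply/seteqP; split=> // x Ax; case: nA; exists x.
have [decode decodeP] : exists decode : C -> T, forall x, A x -> decode (code x) = x.
  have H c : exists y, forall x, A x -> code x = c -> y = x.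
    have [[x [Ax xc]]|nx] := pselect (exists x, A x /\ code x = c).
      by exists x => y Ay yc; apply: codeI; rewrite ?xc.
    by exists x0 => x Ax xc; case: nx; exists x.
  by have [decode dP] := choice H; exists decode => x Ax; apply: dP.
apply: (@sub_finite_set _ _ (decode @` setT)); last exact/finite_image/finite_finset.
by move=> x Ax; exists (code x); rewrite ?decodeP.
Qed.

(** * Finiteness of the set of open subgroups of given index *)

Section CyclotomicSmall.
Variables (K F Om : fieldType) (i : {rmorphism K -> F}) (v : {rmorphism F -> Om}).
Variable d : nat.
Hypothesis d_gt0 : (0 < d)%N.
Hypothesis cyclo : forall x : F, exists n z, ((d ^ n)%N.-primitive_root z)%R /\
  exists P, v x = ((map_poly (v \o i) P).[z])%R.

(** Take an inequivalent family [r] of maximal length over all finite [S]. Its members represent all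
    classes at every finer level, so a subgroup of index [n] is determined by which members it
    contains. *)
Lemma cyclotomic_subfield_small : small i.
Proof.
move=> n; set k := (n`!)%N.
pose good m := `[< exists (S : seq F) (r : nat -> Gal i),
  forall a b, (a < b < m)%N -> ~ pow_equiv k S (r a) (r b) >].
have good0 : exists m, good m.
  by exists 0%N; apply/asboolP; exists [::], (fun=> 1%g) => a b; rewrite andbF.
have good_le m : good m -> (m <= d ^ k * k)%N.
  by move=> /asboolP[S [r rP]]; apply: (inequiv_bound d_gt0 cyclo (fact_gt0 n) rP).
case: (ex_maxnP good0 good_le) => m /asboolP[S [r rP]] m_max.
(* Members inequivalent on [S] remain so on [S'], so an uncovered [s] could be appended to the
   family, against maximality. *)
have cover S' s : {subset S <= S'} -> exists a : 'I_m, pow_equiv k S' (r a) s.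
  move=> SS'; apply: contrapT => /forallNP ns.
  have /m_max : good m.+1; last by rewrite ltnn.
  apply/asboolP; exists S', (fun a => if (a < m)%N then r a else s) => a b /andP[ab].
  rewrite ltnS leq_eqVlt => /predU1P[bm|bm].
    by rewrite bm ltnn -bm ab; rewrite bm in ab; apply: (ns (Ordinal ab)).
  rewrite bm (ltn_trans ab bm) => -[tau tauP]; apply: (rP a b); first by rewrite ab.
  by exists tau => x /SS'; apply: tauP.
apply: (@finite_set_code _ _ _ (fun H : {pred Gal i} => [ffun a : 'I_m => r a \in H])).
move=> H H' [gH oH iH] [gH' oH' iH'] /ffunP HH'.
(* Openness at the identity: the pointwise stabilisers of [l] and [l'] lie in [H] and [H']. Working
   at a level that contains both lists compares [s] with the same [r a] for the two subgroups. *)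
have [l lP] := oH 1%g (proj1 gH); have [l' lP'] := oH' 1%g (proj1 gH').
have memE (J : {pred Gal i}) (S' : seq F) a s : group_closed J -> has_index J n ->
    (forall s', {in S', gal_fun (1%g : Gal i) =1 gal_fun s'} -> s' \in J) ->
    pow_equiv k S' (r a) s -> (s \in J) = (r a \in J).
  move=> gJ iJ JP [tau tauP]; have tauJ := index_exp tau gJ iJ.
  pose g := (r a * tau ^+ k)%g; pose u := (g^-1 * s)%g.
  have uJ : u \in J.
    apply: JP => x xS'; have -> : gal_fun u x = gal_fun (g^-1 * g)%g x by rewrite /= tauP.
    by rewrite mulVg.
  have JM := group_closedM gJ; have JV := group_closedV gJ.
  have sE : s = (g * u)%g by rewrite mulKVg.
  apply/idP/idP => [sJ|rJ]; last by rewrite sE; apply: (JM) => //; apply: (JM).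
  have -> : r a = (s * u^-1 * (tau ^+ k)^-1)%g by rewrite sE !mulgK.
  by apply: (JM); [apply: (JM) => //; apply: (JV) | apply: (JV)].
apply: funext => s.
have [|a ra] := cover (S ++ (l ++ l')) s; first by move=> x xS; rewrite mem_cat xS.
have E := memE H _ a s gH iH _ ra; have E' := memE H' _ a s gH' iH' _ ra.
change ((s \in H) = (s \in H')); rewrite E ?E'.
- by have := HH' a; rewrite !ffunE.
- by move=> s' s'P; apply: lP' => x xl; apply: s'P; rewrite !mem_cat xl !orbT.
- by move=> s' s'P; apply: lP => x xl; apply: s'P; rewrite !mem_cat xl !orbT.
Qed.
End CyclotomicSmall.

Theorem proposition46 (K : fieldType) (Omega : fieldType)
    (iota : {rmorphism {fraction {poly K}} -> Omega})
    (hOmega : is_separable_closure iota)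
    (f : {fraction {poly K}})
    (f_tame : tamely_ramified iota f)
    (f_poly : exists p : {poly K}, f = tofrac p) :
  small (const_field_ext_base iota f).
Proof.
case: f_poly f_tame => p -> f_tame.
have [d_gt0 _] := tame_polynomial_degree f_tame.
apply: (@cyclotomic_subfield_small _ _ _ _ (const_field_emb iota p) _ d_gt0) => x.
exact: const_field_cyclotomic.
Qed.
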